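(* Let $\kappa$ be an integer with $\kappa\neq n/2$ and $\lambda\in V(\mathbb R)$. Then on the open subset of $\mathbb H_n$ where $q(\lambda_{Z^+})\neq0$ and $q(\lambda_{Z^-})\neq0$, $$\xi_{-\kappa}\tilde p_Z(\lambda)=\frac{1}{(\lambda,\psi(Z))^\kappa}.$$
   Context: Setting: $L$ even lattice of signature $(2,n)$, quadratic form $q$, bilinear form $(x,y)=q(x+y)-q(x)-q(y)$, dual $L'$, $V(\mathbb R)=L\otimes\mathbb R$. Fix $e\in L$ primitive isotropic, $e'\in L'$ with $(e,e')=1$, $\tilde e'=e'-q(e')e$, $K=L\cap e^\perp\cap e'^\perp$, $W(\mathbb C)=K\otimes\mathbb C$; $\mathbb H_n$ a connected component of $\{Z=X+iY\in W(\mathbb C):q(Y)>0\}$; $\psi(Z)=Z-q(Z)e+\tilde e'$ with real/imaginary parts $\psi(X),\psi(Y)$; $Z^+=\mathbb R\psi(X)+\mathbb R\psi(Y)$, $Z^-=(Z^+)^\perp$, $\lambda_{Z^\pm}$ orthogonal projections. Hermitian structure: orthogonal basis $b_1,\dots,b_n$ of $K\otimes\mathbb R$ with $q(b_1)=1$, $q(b_j)=-1$ ($j\ge2$), $Z=\sum z_jb_j$; Kähler form $-\frac i2\partial\bar\partial\log q(Y)$, induced pointwise hermitian inner product $\langle,\rangle$ on forms, volume form $d\mu(Z)=(4iq(Y))^{-n}dz_1\wedge d\bar z_1\wedge\dots\wedge dz_n\wedge d\bar z_n$; conjugate-linear Hodge operator defined by $\alpha\wedge\bar*\beta=\langle\alpha,\beta\rangle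 d\mu$; $\bar*_\kappa=q(Y)^\kappa\bar*$; $\xi_\kappa=\bar*_\kappa\bar\partial$. $p_Z(\lambda)=\xi_1\big((\lambda,\psi(\overline Z))/q(Y)\big)$ and $\tilde p_Z(\lambda)=\frac{(\lambda,\psi(Z))^{\kappa-1}}{(-1)^{\frac n2-1}4^\kappa(\kappa-\frac n2)}\frac{p_Z(\lambda)}{q(\lambda_{Z^-})^{n/2}}q(\lambda_{Z^+})^{\frac n2-\kappa}F(1-\frac n2,\kappa-\frac n2;\kappa-\frac n2+1;\frac{q(\lambda)}{q(\lambda_{Z^+})})$, with $F$ the principal branch of the Gauss hypergeometric function.
   Formalization: The constant 4^κ in p̃ is corrected to 4^(κ+1) (as printed the result is off by a factor 4); for odd n, (-1)^(n/2-1) q(λ_{Z^-})^(n/2) is read as (-q(λ_{Z^-}))^(n/2-1) q(λ_{Z^-}); n even with 1≤κ<n/2, where F is undefined, is excluded. *)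

(* Defs.v *)
From HB Require Import structures.
From mathcomp Require Import all_boot all_order all_algebra.
From mathcomp Require Import all_classical all_reals all_analysis.
From mathcomp Require Import complex.

Set Implicit Arguments.
Unset Strict Implicit.
Unset Printing Implicit Defensive.

Import Order.TTheory GRing.Theory Num.Theory numFieldNormedType.Exports.
Local Open Scope classical_set_scope.
Local Open Scope complex_scope.
Local Open Scope ring_scope.

(* An even lattice of rank N is Z^N with an integral symmetric Gram matrix G
   with even diagonal; its elements are the integral row vectors. *)

Section Lattice.
Variable N : nat.
Implicit Type G : 'M[int]_N.

Definition even_lattice G : Prop :=
  G^T = G /\ forall i, (2 %| G i i)%Z.

(* Bilinear and quadratic form extended to F^N; q is determined on the lattice
   by (x, y) = q(x + y) - q(x) - q(y), i.e. q(x) = (x, x) / 2. *)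
Definition bil G (F : fieldType) (x y : 'rV[F]_N) : F :=
  (x *m map_mx intr G *m y^T) 0 0.

Definition quad G (F : fieldType) (x : 'rV[F]_N) : F := bil G x x / 2.

Definition primitive_vector (e : 'rV[int]_N) : Prop :=
  forall (m : int) (v : 'rV[int]_N), e = m *: v -> m = 1 \/ m = - 1.

Variable R : realType.

Definition latR (v : 'rV[int]_N) : 'rV[R]_N := map_mx intr v.

Definition toC m (A : 'M[R]_(m, N)) : 'M[R[i]]_(m, N) := map_mx (real_complex R) A.

Definition dual_vector G (x : 'rV[R]_N) : Prop :=
  forall v : 'rV[int]_N, bil G x (latR v) \is a Num.int.

(* K = L \cap e^perp \cap e'^perp *)
Definition in_K G (e : 'rV[int]_N) (e' : 'rV[R]_N) (v : 'rV[int]_N) : Prop :=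
  bil G (latR v) (latR e) = 0 /\ bil G (latR v) e' = 0.

Definition in_KR G (e : 'rV[int]_N) (e' : 'rV[R]_N) (x : 'rV[R]_N) : Prop :=
  exists (m : nat) (k : 'I_m -> 'rV[int]_N) (a : 'I_m -> R),
    (forall i, in_K G e e' (k i)) /\ x = \sum_(i < m) a i *: latR (k i).

End Lattice.

Definition signature_2n (R : realType) (n : nat) (G : 'M[int]_(2 + n)) : Prop :=
  exists2 P : 'M[R]_(2 + n), P \in unitmx &
    P *m map_mx intr G *m P^T = block_mx 1%:M 0 0 (- 1%:M).

(* The rows b_j of b are an orthogonal basis of K \otimes R
   with q(b_1) = 1 and q(b_j) = -1 for j >= 2. *)
Definition orthogonal_basis_K (R : realType) (n : nat) (G : 'M[int]_(2 + n))
    (e : 'rV[int]_(2 + n)) (e' : 'rV[R]_(2 + n)) (b : 'M[R]_(n, 2 + n)) : Prop :=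
  [/\ row_free b,
      forall x : 'rV[R]_(2 + n), in_KR G e e' x <-> (x <= b)%MS,
      forall i j, i != j -> bil G (row i b) (row j b) = 0 &
      forall j, quad G (row j b) = if val j == 0%N then 1 else - 1].

Section Hypergeometric.
Variable R : realType.

Definition poch (a : R) (k : nat) : R := \prod_(i < k) (a + i%:R).

Definition hyp_coef (a b c : R) (k : nat) : R :=
  poch a k * poch b k / (poch c k * (k`!)%:R).

(* No division by zero in the series: if c = -k, then the numerators vanish
   from degree k+1 on (the series is the polynomial of its nonzero numerators). *)
Definition hyp_defined (a b c : R) : Prop :=
  forall k : nat, c = - k%:R ->
    exists2 m : nat, (m <= k)%N & a = - m%:R \/ b = - m%:R.

Definition powser (c : nat -> R[i]) (w0 w : R[i]) : nat -> R[i] :=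
  series (fun k => c k * (w - w0) ^+ k).

Definition slit_plane : set R[i] := [set w | ~ (complex.Im w = 0 /\ 1 <= complex.Re w)].

(* F is the principal branch of F(a, b; c; .): the analytic continuation of the
   hypergeometric series from the unit disc to C \ [1, +oo[.  By the identity
   theorem this determines F on the slit plane. *)
Definition principal_2F1 (a b c : R) (F : R[i] -> R[i]) : Prop :=
  [/\ hyp_defined a b c,
      forall w : R[i], `|w| < 1 ->
        powser (fun k => (hyp_coef a b c k)%:C) 0 w @ \oo --> (F w : R[i]^o) &
      forall w0 : R[i], slit_plane w0 ->
        exists (r : R) (d : nat -> R[i]), 0 < r /\
          forall w : R[i], `|w - w0| < r%:C ->
            powser d w0 w @ \oo --> (F w : R[i]^o)].

End Hypergeometric.

(* Exterior algebra on dz_1, ..., dz_n, d\bar z_1, ..., d\bar z_n.  The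
   generators are indexed by 'I_(n + n): lshift n j stands for dz_j and
   rshift n j for d\bar z_j.  A form is given by its coefficients on the
   monomials e_S, the wedge products of the generators in S in increasing
   order. *)

Section Forms.
Variables (R : realType) (n : nat).

Definition form : Type := {ffun {set 'I_(n + n)} -> R[i]}.
HB.instance Definition _ := GRing.Zmodule.on form.

Definition fscale (c : R[i]) (u : form) : form := [ffun S => c * u S].

Definition fconst (c : R[i]) : form := [ffun S => if S == finset.set0 then c else 0].

Definition gen (i : 'I_(n + n)) : form := [ffun S => (S == [set i]%SET)%:R].

Definition dz (j : 'I_n) : form := gen (lshift n j).
Definition dzbar (j : 'I_n) : form := gen (rshift n j).

(* e_A /\ e_B = shuffle_sign A B e_(A \cup B) for disjoint A and B *)
Definition shuffle_sign (A B : {set 'I_(n + n)}) : R[i] :=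
  (- 1) ^+ #|[set p in finset.setX A B | (p.2 < p.1)%N]%SET|.

Definition wedge (u v : form) : form :=
  [ffun S : {set 'I_(n + n)} =>
     \sum_(A in powerset S) shuffle_sign A (S :\: A) * u A * v (S :\: A)].

Definition has_bidegree (p q : nat) (u : form) : Prop :=
  forall S : {set 'I_(n + n)}, u S != 0 ->
    #|[set j : 'I_n | lshift n j \in S]%SET| = p /\
    #|[set j : 'I_n | rshift n j \in S]%SET| = q.

Definition real_partial (v : 'rV[R[i]]_n) (f : 'rV[R[i]]_n -> R[i])
    (z : 'rV[R[i]]_n) : R[i] :=
  derive1 (fun t : R => complex.Re (f (z + t%:C *: v))) 0 +i*
  derive1 (fun t : R => complex.Im (f (z + t%:C *: v))) 0.

(* d/dz_j = (d/dx_j - i d/dy_j) / 2,  d/d\bar z_j = (d/dx_j + i d/dy_j) / 2 *)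
Definition d_z (j : 'I_n) (f : 'rV[R[i]]_n -> R[i]) (z : 'rV[R[i]]_n) : R[i] :=
  (real_partial (delta_mx 0 j) f z -
     'i%C * real_partial ('i%C *: delta_mx 0 j) f z) / 2.

Definition d_zbar (j : 'I_n) (f : 'rV[R[i]]_n -> R[i]) (z : 'rV[R[i]]_n) : R[i] :=
  (real_partial (delta_mx 0 j) f z +
     'i%C * real_partial ('i%C *: delta_mx 0 j) f z) / 2.

Definition del (w : 'rV[R[i]]_n -> form) (z : 'rV[R[i]]_n) : form :=
  \sum_(j < n) wedge (dz j) [ffun S => d_z j (fun z' => w z' S) z].

Definition delbar (w : 'rV[R[i]]_n -> form) (z : 'rV[R[i]]_n) : form :=
  \sum_(j < n) wedge (dzbar j) [ffun S => d_zbar j (fun z' => w z' S) z].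

(* Minor of M with rows in S and columns in T, for #|S| = #|T| (the default
   value of nth is then never used). *)
Definition set_minor (M : 'M[R[i]]_(n + n)) (S T : {set 'I_(n + n)}) : R[i] :=
  \det (\matrix_(i < #|S|, k < #|S|)
          M (enum_val i) (nth (enum_val i) (enum T) k)).

(* Hermitian inner product on the exterior algebra whose Gram matrix on the
   generators is M: <e_S, e_T> = det (M s t)_(s in S, t in T). *)
Definition herm_form (M : 'M[R[i]]_(n + n)) (u v : form) : R[i] :=
  \sum_(S : {set 'I_(n + n)}) \sum_(T : {set 'I_(n + n)} | #|T| == #|S|)
     u S * conjc (v T) * set_minor M S T.

End Forms.

Section Tube.
Variables (R : realType) (n : nat) (G : 'M[int]_(2 + n)).
Variables (e : 'rV[int]_(2 + n)) (e' : 'rV[R]_(2 + n)) (b : 'M[R]_(n, 2 + n)).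
Implicit Type z : 'rV[R[i]]_n.

(* Z = \sum_j z_j b_j *)
Definition Zvec z : 'rV[R[i]]_(2 + n) := z *m toC b.

Definition Yvec z : 'rV[R]_(2 + n) := map_mx (@complex.Im R) (Zvec z).

Definition qY z : R := quad G (Yvec z).

Definition tube : set 'rV[R[i]^o]_n := [set z | 0 < qY z].

Definition etilde : 'rV[R]_(2 + n) := e' - quad G e' *: latR R e.

Definition psi z : 'rV[R[i]]_(2 + n) :=
  Zvec z - quad G (Zvec z) *: toC (latR R e) + toC etilde.

Definition psiX z : 'rV[R]_(2 + n) := map_mx (@complex.Re R) (psi z).
Definition psiY z : 'rV[R]_(2 + n) := map_mx (@complex.Im R) (psi z).

Definition Zplus z : 'M[R]_(2 + n) := (psiX z + psiY z)%MS.
Definition Zminus z : 'M[R]_(2 + n) := kermx (map_mx intr G *m (Zplus z)^T).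

Definition lamplus (lam : 'rV[R]_(2 + n)) z : 'rV[R]_(2 + n) :=
  lam *m proj_mx (Zplus z) (Zminus z).
Definition lamminus (lam : 'rV[R]_(2 + n)) z : 'rV[R]_(2 + n) :=
  lam *m proj_mx (Zminus z) (Zplus z).

Definition kahler z : form R n :=
  fscale (- 'i%C / 2) (del (delbar (fun z' => fconst n (ln (qY z'))%:C)) z).

(* Metric g_jk = <d/dz_j, d/dz_k> with Kaehler form i \sum_jk g_jk dz_j /\ d\bar z_k.
   This is the normalisation for which the flat form (i/2) dz /\ d\bar z gives
   dx and dy length 1, and for which the volume form below has length 1. *)
Definition metric z : 'M[R[i]]_n :=
  \matrix_(j, k) (kahler z [set lshift n j; rshift n k]%SET / 'i%C).

(* Gram matrix of the dual coframe dz_1, ..., dz_n, d\bar z_1, ..., d\bar z_n. *)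
Definition cometric z : 'M[R[i]]_(n + n) :=
  block_mx (invmx (metric z))^T 0 0 (map_mx conjc (invmx (metric z))^T).

Definition herm z (u v : form R n) : R[i] := herm_form (cometric z) u v.

Definition vol z : form R n :=
  fscale ((4 * 'i%C * (qY z)%:C) ^- n)
    (\big[@wedge R n/fconst n 1]_(j < n) wedge (dz R j) (dzbar R j)).

(* The Hodge operator on (p,q)-forms at z: the (n-p,n-q)-form barstar v with
   u /\ barstar v = <u, v> vol for all (p,q)-forms u. *)
Definition barstar (p q : nat) z (v : form R n) : form R n :=
  xget 0 [set w | has_bidegree (n - p) (n - q) w /\
    forall u : form R n, has_bidegree p q u ->
      wedge u w = fscale (herm z u v) (vol z)].

(* w is a field of (p,q)-forms. *)
Definition xi (p q : nat) (kappa : int) (w : 'rV[R[i]]_n -> form R n) z : form R n :=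
  fscale ((qY z)%:C ^ kappa) (barstar p q.+1 z (delbar w z)).

Definition lam_psi (lam : 'rV[R]_(2 + n)) z : R[i] := bil G (toC lam) (psi z).

Definition pZ (lam : 'rV[R]_(2 + n)) : 'rV[R[i]]_n -> form R n :=
  xi 0 0 1 (fun z => fconst n (lam_psi lam (map_mx conjc z) / (qY z)%:C)).

(* For x = q(lam_(Z^-)) < 0 the product (-1)^(n/2-1) x^(n/2) is read with
   compatible branches, (-1)^s x^s = (-x)^s, as (-x)^(n/2-1) x; for even n this
   is an identity, for odd n two independent principal branches would differ
   from it by a sign.
   The constant is 4^(kappa+1), not 4^kappa: with the inner product [herm] this
   is the value for which xi_(-kappa) maps ptilde exactly to
   (lam, psi(Z))^(-kappa), without a further factor 4.  Check for n = 1, q(lam) = 0,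
   (lam, psi(Z)) = 1: pZ = - dz / y, q(lam_(Z^+)) = 1 / (4 y^2) and F = 1. *)
Definition ptilde (kappa : int) (F : R[i] -> R[i]) (lam : 'rV[R]_(2 + n)) z : form R n :=
  let qp := quad G (lamplus lam z) in
  let qm := quad G (lamminus lam z) in
  let h : R := n%:R / 2 in
  fscale
    (lam_psi lam z ^ (kappa - 1)
     / (4 ^ (kappa + 1) * (kappa%:~R - h) * ((- qm) `^ (h - 1) * qm))%:C
     * (qp `^ (h - kappa%:~R))%:C * F (quad G lam / qp)%:C)
    (pZ lam z).

End Tube.

(* Main.v *)
(** In the coordinates Z = sum_j z_j b_j put y = Im z, eps_j = q(b_j), Q = q(Y)
    and P = (lam, psi(Z)), a holomorphic quadratic polynomial in z.  The cometric is
    8 y y^T - 4 Q diag(eps), and q(lam_(Z^+)) = |P|^2 / (4 Q) =: t.  Up to signs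
    the coefficients of the (n, n-1)-form pZ are a constant times Q^-n N_k, where
      sum_k (d/d\bar z_k) (Q^-n N_k) = 2 n P Q^-n  and
      sum_k N_k (d/d\bar z_k) t = 4 P (t - q(lam)).
    Writing ptilde = P^(kappa-1) phi(t) pZ, the claim thus reduces to the ordinary
    differential equation (n/2) phi + (t - q(lam)) phi' = 4^(-kappa-1) t^(-kappa),
    which amounts to w F' + c F = c (1 - w)^(n/2-1) for c = kappa - n/2 at the point
    w = q(lam) / t < 1.  The latter equation is read off the power series near 0
    and extends to ]-oo, 1[ by the identity theorem. *)
Require Import Defs.
From HB Require Import structures.
From mathcomp Require Import all_boot all_order perm all_algebra.
From mathcomp Require Import all_classical all_reals all_analysis.
From mathcomp Require Import complex ring lra.
Import Order.TTheory GRing.Theory Num.Theory numFieldNormedType.Exports.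
Local Open Scope classical_set_scope.
Local Open Scope complex_scope.
Local Open Scope ring_scope.

Set Implicit Arguments.
Unset Strict Implicit.
Unset Printing Implicit Defensive.

(** * Derivatives of complex-valued functions of a real variable *)

Section ComplexValuedDerivative.
Variable R : realType.
Implicit Types (f g : R -> R[i]) (l m : R[i]).

(** The definition of [F] gives only its series at 0 and unspecified local expansions. The
    differential equation is needed only at real arguments below 1, so real power series on ]-oo, 1[
    suffice. That w = q(lam) / t is below 1 comes from the signature: q(lam_(Z^-)) = q(lam) - t is
    at most 0, and it is nonzero by hypothesis. Write E for the derivative of P along Y. Neither
    identity for N_k contains E, although N_k does: in the first, the exponent -n of Q makes the
    contributions of E cancel; in the second, they cancel through a quadratic relation between P, E
    and the gradient of P, and this relation is where q(lam) enters. The constant 4^(-kappa-1) is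
    the one for which 4 P^kappa 4^(-kappa-1) t^(-kappa), with t = |P|^2 / (4 Q), equals Q^kappa
    times the conjugate of P^(-kappa). The two Hodge operators involved, in bidegrees (0, 1) and (n,
    n), each bring the orientation sign of the volume form once, so that sign is never computed. *)

Lemma is_derive_invr (f : R -> R) (x df : R) : f x != 0 ->
  is_derive x 1 f df -> is_derive x 1 (fun t => (f t)^-1) (- (f x) ^- 2 * df).
Proof.
move=> fx0 [Df ef].
have D := derivableV fx0 Df.
apply: DeriveDef => //.
by rewrite (deriveV fx0 Df) ef.
Qed.

(** Taken at 0 and by components because [real_partial] differentiates [Re] and [Im] along a line
    separately. Asserting [is_derive] rather than a value carries derivability through the product
    and quotient rules. *)
Definition cderiv f l :=
  is_derive (0 : R) 1 (fun t => complex.Re (f t)) (complex.Re l) /\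
  is_derive (0 : R) 1 (fun t => complex.Im (f t)) (complex.Im l).

Lemma cderiv_eq f l m : cderiv f l -> l = m -> cderiv f m.
Proof. by move=> ? <-. Qed.

Lemma cderiv_near f g l :
  (\forall t \near (0 : R), f t = g t) -> cderiv f l -> cderiv g l.
Proof.
move=> fg [Dr Di]; split.
  by apply: near_eq_is_derive Dr; apply: filterS fg => t ->.
by apply: near_eq_is_derive Di; apply: filterS fg => t ->.
Qed.

Lemma cderiv_cst (c : R[i]) : cderiv (fun=> c) 0.
Proof. by split; apply: is_derive_cst. Qed.

Lemma cderivD f g l m :
  cderiv f l -> cderiv g m -> cderiv (fun t => f t + g t) (l + m).
Proof.
case: l m => [l1 l2] [m1 m2] [/= fr fi] [/= gr gi]; split.
  rewrite (_ : (fun t => _) = (fun t => complex.Re (f t)) + (fun t => complex.Re (g t))).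
    exact: is_deriveD.
  by apply/funext => t; rewrite fctE; case: (f t); case: (g t).
rewrite (_ : (fun t => _) = (fun t => complex.Im (f t)) + (fun t => complex.Im (g t))).
  exact: is_deriveD.
by apply/funext => t; rewrite fctE; case: (f t); case: (g t).
Qed.

Lemma cderivM f g l m : cderiv f l -> cderiv g m ->
  cderiv (fun t => f t * g t) (l * g 0 + f 0 * m).
Proof.
case: l m => [l1 l2] [m1 m2] [/= fr fi] [/= gr gi]; split.
  rewrite (_ : (fun t => _) =
     (fun t => complex.Re (f t)) * (fun t => complex.Re (g t))
     - (fun t => complex.Im (f t)) * (fun t => complex.Im (g t))); last first.
    by apply/funext => t; rewrite !fctE; case: (f t); case: (g t).
  apply: is_derive_eq (is_deriveB (is_deriveM fr gr) (is_deriveM fi gi)) _.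
  by case: (f 0) (g 0) => [a b] [c d] /=; rewrite /GRing.scale /=; ring.
rewrite (_ : (fun t => _) =
   (fun t => complex.Re (f t)) * (fun t => complex.Im (g t))
   + (fun t => complex.Im (f t)) * (fun t => complex.Re (g t))); last first.
  by apply/funext => t; rewrite !fctE; case: (f t); case: (g t).
apply: is_derive_eq (is_deriveD (is_deriveM fr gi) (is_deriveM fi gr)) _.
by case: (f 0) (g 0) => [a b] [c d] /=; rewrite /GRing.scale /=; ring.
Qed.

Lemma cderiv_real (g : R -> R) (l : R) :
  is_derive (0 : R) 1 g l -> cderiv (fun t => (g t)%:C) l%:C.
Proof. by move=> Dg; split => //=; apply: is_derive_cst. Qed.

Lemma cderiv_conj f l : cderiv f l -> cderiv (fun t => (f t)^*) l^*.
Proof.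
case: l => [a b] [fr fi]; split => /=.
  rewrite (_ : (fun t => _) = fun t => complex.Re (f t)) //.
  by apply/funext => t; case: (f t).
rewrite (_ : (fun t => _) = - (fun t => complex.Im (f t))).
  exact: is_deriveN.
by apply/funext => t; rewrite fctE; case: (f t).
Qed.

Lemma cderiv_sum (I : Type) (r : seq I) (f : I -> R -> R[i]) (l : I -> R[i]) :
  (forall i, cderiv (f i) (l i)) ->
  cderiv (fun t => \sum_(i <- r) f i t) (\sum_(i <- r) l i).
Proof.
move=> Df; elim: r => [|i r IH].
  rewrite big_nil (_ : (fun t => _) = fun=> 0); first exact: cderiv_cst.
  by apply/funext => t; rewrite big_nil.
rewrite big_cons (_ : (fun t => _) = fun t => f i t + \sum_(i <- r) f i t).
  exact: cderivD.
by apply/funext => t; rewrite big_cons.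
Qed.

Lemma cderivV f l : f 0 != 0 -> cderiv f l ->
  cderiv (fun t => (f t)^-1) (- (f 0) ^- 2 * l).
Proof.
move=> f0 Df; have [fr fi] := Df.
pose N t := complex.Re (f t) ^+ 2 + complex.Im (f t) ^+ 2.
have invE z : z^-1 = z^* * ((complex.Re z ^+ 2 + complex.Im z ^+ 2)^-1)%:C :> R[i].
  by case: z => a b; apply/eqP; rewrite eq_complex /= !mulr0 subr0 add0r mulNr !eqxx.
have N0 : N 0 != 0.
  apply: contra f0; rewrite /N paddr_eq0 ?sqr_ge0 // !sqrf_eq0 => /andP[/eqP a0 /eqP b0].
  by rewrite eq_complex a0 b0 /= !eqxx.
have DN : is_derive (0 : R) 1 N
    (2 * complex.Re (f 0) * complex.Re l + 2 * complex.Im (f 0) * complex.Im l).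
  rewrite /N (_ : (fun t => _) = (fun t => complex.Re (f t)) ^+ 2 + (fun t => complex.Im (f t)) ^+ 2).
        apply: is_derive_eq (is_deriveD (is_deriveX 2 fr) (is_deriveX 2 fi)) _.
    by rewrite /GRing.scale /= !expr1.
  by apply/funext => t.
have := cderivM (cderiv_conj Df) (cderiv_real (is_derive_invr N0 DN)).
rewrite (_ : (fun t => _) = (fun t => (f t)^-1)); last first.
  by apply/funext => t; rewrite invE.
move/cderiv_eq; apply.
move: N0; rewrite /N; case: (f 0) (l) => [a b] [c d] /= N0.
have : (a +i* b) ^+ 2 != 0.
  by rewrite expf_neq0 //; apply: contra N0; rewrite eq_complex /= => /andP[/eqP-> /eqP->]; rewrite expr0n addr0.
(* Once f(0)^2 is cleared, both components are identities over R whose only denominator is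
   |f(0)|^2. *)
move=> Z0; apply: (mulfI Z0); rewrite !mulrA mulrN mulfV // mulN1r.
apply/eqP; rewrite eq_complex /= expr2 /=; apply/andP; split; apply/eqP; field; exact: N0.
Qed.

End ComplexValuedDerivative.

(** * Wirtinger derivatives *)

Section WirtingerDerivative.
Variables (R : realType) (n : nat).
Implicit Types (f g : 'rV[R[i]]_n -> R[i]) (z v : 'rV[R[i]]_n) (a b c d : R[i]).

(** Here [a] and [b] are the derivatives with respect to z_j and its conjugate: along 1 and i the
    line derivatives are a + b and i (a - b). Keeping both makes the relation stable under
    conjugation, which exchanges them. *)
Definition has_wirtinger (j : 'I_n) f z a b :=
  cderiv (fun t => f (z + t%:C *: delta_mx 0 j)) (a + b) /\
  cderiv (fun t => f (z + t%:C *: ('i%C *: delta_mx 0 j))) ('i%C * (a - b)).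

Lemma line0 z v : z + (0 : R)%:C *: v = z.
Proof. by rewrite scale0r addr0. Qed.

Lemma real_partial_cderiv v f z l :
  cderiv (fun t => f (z + t%:C *: v)) l -> real_partial v f z = l.
Proof.
by move=> [[_ er] [_ ei]]; rewrite /real_partial !derive1E er ei; case: l er ei.
Qed.

Lemma sqr_iC : ('i%C : R[i]) * 'i%C = - 1.
Proof. by rewrite -expr2 sqr_i. Qed.

Lemma d_z_wirtinger j f z a b : has_wirtinger j f z a b -> d_z j f z = a.
Proof.
move=> [/real_partial_cderiv h1 /real_partial_cderiv h2].
by rewrite /d_z h1 h2 mulrA sqr_iC; field.
Qed.

Lemma d_zbar_wirtinger j f z a b : has_wirtinger j f z a b -> d_zbar j f z = b.
Proof.
move=> [/real_partial_cderiv h1 /real_partial_cderiv h2].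
by rewrite /d_zbar h1 h2 mulrA sqr_iC; field.
Qed.

Lemma has_wirtinger_eq j f z a b c d :
  has_wirtinger j f z a b -> a = c -> b = d -> has_wirtinger j f z c d.
Proof. by move=> ? <- <-. Qed.

Lemma has_wirtinger_cst j c z : has_wirtinger j (fun=> c) z 0 0.
Proof.
by split; apply: (cderiv_eq (cderiv_cst _)); rewrite ?subr0 ?addr0 ?mulr0.
Qed.

Lemma has_wirtinger_coord j k z :
  has_wirtinger j (fun z' => z' 0 k) z (k == j)%:R 0.
Proof.
have Dt c : cderiv (fun t : R => z 0 k + t%:C * c) c.
  have := cderivD (cderiv_cst (z 0 k))
    (cderivM (cderiv_real (is_derive_id (0 : R) 1)) (cderiv_cst c)).
  by move/cderiv_eq; apply; rewrite rmorph1 mul1r mulr0 addr0 add0r.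
split.
  rewrite (_ : (fun t => _) = fun t : R => z 0 k + t%:C * (k == j)%:R).
    by apply: cderiv_eq (Dt _) _; rewrite addr0.
  by apply/funext => t; rewrite !mxE eqxx.
rewrite (_ : (fun t => _) = fun t : R => z 0 k + t%:C * ('i%C * (k == j)%:R)).
  by apply: cderiv_eq (Dt _) _; rewrite subr0.
by apply/funext => t; rewrite !mxE eqxx.
Qed.

Lemma has_wirtingerD j f g z a b c d :
  has_wirtinger j f z a b -> has_wirtinger j g z c d ->
  has_wirtinger j (fun z => f z + g z) z (a + c) (b + d).
Proof.
move=> [f1 f2] [g1 g2]; split.
  by apply: cderiv_eq (cderivD f1 g1) _; ring.
by apply: cderiv_eq (cderivD f2 g2) _; ring.
Qed.

Lemma has_wirtingerM j f g z a b c d :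
  has_wirtinger j f z a b -> has_wirtinger j g z c d ->
  has_wirtinger j (fun z => f z * g z) z (a * g z + f z * c) (b * g z + f z * d).
Proof.
move=> [f1 f2] [g1 g2]; split.
  by apply: cderiv_eq (cderivM f1 g1) _; rewrite !line0; ring.
by apply: cderiv_eq (cderivM f2 g2) _; rewrite !line0; ring.
Qed.

Lemma has_wirtingerZ j f z a b c :
  has_wirtinger j f z a b ->
  has_wirtinger j (fun z => c * f z) z (c * a) (c * b).
Proof.
move=> /(has_wirtingerM (has_wirtinger_cst j c z)) /has_wirtinger_eq.
by apply; rewrite mul0r add0r.
Qed.

Lemma has_wirtingerN j f z a b :
  has_wirtinger j f z a b -> has_wirtinger j (fun z => - f z) z (- a) (- b).
Proof.
move=> /(has_wirtingerZ (-1)); rewrite !mulN1r.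
by rewrite (_ : (fun z => _) = fun z => - f z) //; apply/funext => ?; rewrite mulN1r.
Qed.

Lemma has_wirtinger_conj j f z a b :
  has_wirtinger j f z a b -> has_wirtinger j (fun z => (f z)^*) z b^* a^*.
Proof.
move=> [f1 f2]; split.
  by apply: cderiv_eq (cderiv_conj f1) _; rewrite rmorphD addrC.
apply: cderiv_eq (cderiv_conj f2) _.
case: a b {f1 f2} => [a1 a2] [b1 b2]; apply/eqP; rewrite eq_complex /=.
by apply/andP; split; apply/eqP; ring.
Qed.

Lemma has_wirtinger_sum (I : Type) (r : seq I) j (f : I -> 'rV[R[i]]_n -> R[i])
    z (a b : I -> R[i]) :
  (forall i, has_wirtinger j (f i) z (a i) (b i)) ->
  has_wirtinger j (fun z => \sum_(i <- r) f i z) z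
    (\sum_(i <- r) a i) (\sum_(i <- r) b i).
Proof.
move=> Df; split.
  apply: cderiv_eq (cderiv_sum r (fun i => (Df i).1)) _.
  by rewrite big_split.
apply: cderiv_eq (cderiv_sum r (fun i => (Df i).2)) _.
by rewrite -sumrB mulr_sumr.
Qed.

Lemma has_wirtingerV j f z a b : f z != 0 -> has_wirtinger j f z a b ->
  has_wirtinger j (fun z => (f z)^-1) z (- (f z) ^- 2 * a) (- (f z) ^- 2 * b).
Proof.
move=> fz [f1 f2]; split.
  by apply: cderiv_eq (cderivV _ f1) _; rewrite line0 //; ring.
by apply: cderiv_eq (cderivV _ f2) _; rewrite line0 //; ring.
Qed.

Lemma has_wirtingerX j f z a b k : has_wirtinger j f z a b ->
  has_wirtinger j (fun z => f z ^+ k.+1) z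
    (k.+1%:R * f z ^+ k * a) (k.+1%:R * f z ^+ k * b).
Proof.
move=> Df; elim: k => [|k IH]; first by rewrite !mul1r.
rewrite (_ : (fun z => _) = fun z => f z * f z ^+ k.+1); last first.
  by apply/funext => z'; rewrite exprS.
apply: has_wirtinger_eq (has_wirtingerM Df IH) _ _.
  by rewrite -[in RHS]natr1 exprS; ring.
by rewrite -[in RHS]natr1 exprS; ring.
Qed.

Lemma has_wirtinger_exprz j f z a b (k : int) :
  f z != 0 -> has_wirtinger j f z a b ->
  has_wirtinger j (fun z => f z ^ k) z
    (k%:~R * f z ^ (k - 1) * a) (k%:~R * f z ^ (k - 1) * b).
Proof.
move=> fz Df; case: k => [[|k]|k].
- rewrite !mul0r (_ : (fun z => _) = fun=> 1); first exact: has_wirtinger_cst.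
  by apply/funext.
- apply: has_wirtinger_eq (has_wirtingerX k Df) _ _.
    by rewrite intS addrAC subrr add0r.
  by rewrite intS addrAC subrr add0r.
have fk : f z ^+ k.+1 != 0 by rewrite expf_neq0.
have E c : - (f z ^+ k.+1) ^- 2 * (k.+1%:R * f z ^+ k * c)
    = (Negz k)%:~R * f z ^ (Negz k - 1) * c.
  rewrite NegzE mulrNz (_ : - k.+1%:Z - 1 = - k.+2%:Z); last first.
    by rewrite -opprD [in RHS]intS addrC.
  rewrite -exprnN -[k.+1%:~R]/(k.+1%:R) !exprS.
  by field; rewrite fz expf_neq0.
by apply: has_wirtinger_eq (has_wirtingerV fk (has_wirtingerX k Df)) _ _; rewrite E.
Qed.

Lemma has_wirtinger_real_comp j (g : 'rV[R[i]]_n -> R) (phi : R -> R) z a b (d : R) :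
  has_wirtinger j (fun z => (g z)%:C) z a b -> is_derive (g z) 1 phi d ->
  has_wirtinger j (fun z => (phi (g z))%:C) z (d%:C * a) (d%:C * b).
Proof.
move=> [[r1 [_ i1]] [r2 [_ i2]]] Dphi.
(* The imaginary part of [(g z)%:C] is constantly 0, so each line derivative is real and the real
   chain rule for [phi] can be read over R[i]. *)
have Im0 (l : R[i]) : 'D_1 (cst 0 : R -> R) (0 : R) = complex.Im l ->
    l = (complex.Re l)%:C.
  by rewrite derive_cst; case: l => u w /= <-.
split.
  have D : is_derive (complex.Re (g (z + (0 : R)%:C *: delta_mx 0 j))%:C) 1 phi d.
    by rewrite line0.
  apply: cderiv_eq (cderiv_real (is_derive1_comp D r1)) _.
  by rewrite rmorphM /= -mulrDr [in RHS](Im0 _ i1).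
have D : is_derive (complex.Re (g (z + (0 : R)%:C *: ('i%C *: delta_mx 0 j)))%:C) 1 phi d.
  by rewrite line0.
apply: cderiv_eq (cderiv_real (is_derive1_comp D r2)) _.
by rewrite rmorphM /= -mulrBr [in RHS]mulrCA [in RHS](Im0 _ i2).
Qed.

(** Derivability along a line makes [Q] and [T] continuous there, so both stay positive for small t.
    This suffices, since only line derivatives are compared, and it allows closed forms valid on an
    open region to be differentiated. *)
Lemma has_wirtinger_eq_pos j (Q T : 'rV[R[i]]_n -> R) f g z a b c d c' d' :
  has_wirtinger j (fun z => (Q z)%:C) z c d -> 0 < Q z ->
  has_wirtinger j (fun z => (T z)%:C) z c' d' -> 0 < T z ->
  (forall z', 0 < Q z' -> 0 < T z' -> f z' = g z') ->
  has_wirtinger j f z a b -> has_wirtinger j g z a b.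
Proof.
move=> [[[q1 _] _] [[q2 _] _]] Qz [[[t1 _] _] [[t2 _] _]] Tz fg.
have pos (P : 'rV[R[i]]_n -> R) v : 0 < P z ->
    derivable (fun t : R => complex.Re (P (z + t%:C *: v))%:C) 0 1 ->
    \forall t \near (0 : R), 0 < P (z + t%:C *: v).
  move=> Pz /derivable1_diffP /differentiable_continuous /= pc.
  by have := @cvgr_gt _ _ _ _ _ _ pc 0; rewrite /= line0; exact.
have eqfg v : derivable (fun t : R => complex.Re (Q (z + t%:C *: v))%:C) 0 1 ->
    derivable (fun t : R => complex.Re (T (z + t%:C *: v))%:C) 0 1 ->
    \forall t \near (0 : R), f (z + t%:C *: v) = g (z + t%:C *: v).
  move=> /(pos _ _ Qz) Qn /(pos _ _ Tz) Tn.
  by apply: filterS2 Qn Tn => t; exact: fg.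
move=> [f1 f2]; split; [exact: cderiv_near (eqfg _ q1 t1) f1|exact: cderiv_near (eqfg _ q2 t2) f2].
Qed.

End WirtingerDerivative.

(** * Real power series and the identity theorem on ]-oo, 1[ *)

Section LocalPowerSeries.
Variable R : realType.
Implicit Types (f g : R -> R) (d c : nat -> R) (x u r K : R).

Lemma between_norm u r : `|u| < r -> exists2 s : R, `|u| < `|s| & `|s| < r.
Proof.
move=> ur; have [h1 h2] := midf_lt ur.
have s0 : 0 < (`|u| + r) / 2 by exact: le_lt_trans (normr_ge0 u) h1.
by exists ((`|u| + r) / 2); rewrite (gtr0_norm s0).
Qed.

(** The difference s^(m+1) - a^(m+1) is s - a times a sum of m + 1 products s^i a^(m-i), each at
    least a^m. *)
Lemma natmul_expr_le (a s : R) m : 0 <= a -> a < s ->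
  m.+1%:R * a ^+ m * (s - a) + a ^+ m.+1 <= s ^+ m.+1.
Proof.
move=> a0 sa; have s0 : 0 <= s := le_trans a0 (ltW sa).
elim: m => [|m IH]; first by rewrite !expr1 expr0; lra.
rewrite (exprS s) (le_trans _ (ler_wpM2l s0 IH)) //.
have am : 0 <= a ^+ m by exact: exprn_ge0.
rewrite -subr_ge0 (_ : _ - _ = m.+1%:R * a ^+ m * (s - a) ^+ 2).
  by rewrite mulr_ge0 ?sqr_ge0 // mulr_ge0.
by rewrite -(natr1 m.+1) !exprS; ring.
Qed.

Lemma cvg_of_shiftS (s : nat -> R) (l : R) :
  (fun k => s k.+1) @ \oo --> l -> s @ \oo --> l.
Proof. by rewrite cvg_shiftS. Qed.

Lemma is_cvg_series_shiftS (s : nat -> R) :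
  cvgn (series s) -> cvgn (series (fun k => s k.+1)).
Proof.
move=> cs; have -> : series (fun k => s k.+1) = (fun k => series s k.+1 - s 0%N).
  by apply/funext => k; rewrite /series /= big_nat_recl // addrAC subrr add0r.
apply: is_cvgB; last exact: is_cvg_cst.
by move/cvg_ex : cs => [l cs]; apply/cvg_ex; exists l; rewrite cvg_shiftS.
Qed.

Lemma is_cvg_pseries_diffs d K u :
  cvgn (pseries d K) -> `|u| < `|K| -> cvgn (pseries (pseries_diffs d) u).
Proof.
move=> dK /between_norm[s us sK].
have := is_cvg_series_shiftS (is_cvg_pseries_inside_norm dK (_ : `| `|s| | < `|K|)).
rewrite normr_id => /(_ sK) C0.
(* By [natmul_expr_le], the factor (|s| - |u|)^-1 absorbs the k + 1 of the differentiated term, at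
   the price of passing from |u| to |s|. *)
have C := is_cvg_seriesZ (k := (`|s| - `|u|)^-1) C0.
have su : 0 < `|s| - `|u| by rewrite subr_gt0.
apply: normed_cvg; apply: (series_le_cvg _ _ _ C) => k //=.
  by rewrite /GRing.scale /= !mulr_ge0 // ?invr_ge0 ?(ltW su) ?exprn_ge0.
rewrite ler_pdivlMl // /pseries_diffs !normrM normrX normr_nat.
rewrite [X in X <= _](_ : _ = `|d k.+1| * (k.+1%:R * `|u| ^+ k * (`|s| - `|u|))); last by ring.
rewrite ler_wpM2l // (le_trans _ (natmul_expr_le k (normr_ge0 u) us)) //.
by rewrite lerDl exprn_ge0.
Qed.

(** The expansion holds on the whole open interval of radius [r]. All closure properties below keep
    [r], so no radius ever has to be shrunk. *)
Definition has_pseries f x r d :=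
  0 < r /\ forall u, `|u| < r -> pseries d u @ \oo --> f (x + u).

Lemma has_pseries_is_derive f x r d u : has_pseries f x r d -> `|u| < r ->
  is_derive (x + u) 1 f (limn (pseries (pseries_diffs d) u)).
Proof.
move=> [r0 fd] ur.
(* Termwise differentiation at [u] asks for convergence of the series and of its first two formal
   derivatives at [K1]; each formal derivative costs a slightly larger point. *)
have [K1 uK1 K1r] := between_norm ur.
have [K2 K12 K2r] := between_norm K1r.
have [K3 K23 K3r] := between_norm K2r.
have d3 : cvgn (pseries d K3) by apply/cvg_ex; exists (f (x + K3)); exact: fd.
have d2 := is_cvg_pseries_diffs d3 K23.
have d1 := is_cvg_pseries_diffs d2 K12.
have C1 := is_cvg_pseries_inside d3 (lt_trans K12 K23).
have C2 := is_cvg_pseries_inside d2 K12.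
have D := pseries_snd_diffs C1 C2 d1 uK1.
have E : is_derive u 1 (fun v => f (x + v)) (limn (pseries (pseries_diffs d) u)).
  apply: near_eq_is_derive D.
  have : \forall v \near u, `|v| < r.
    exact: (cvgr_lt _ (@norm_continuous _ R u)) _ ur.
  by apply: filterS => v vr; apply/cvg_lim; [exact: Rhausdorff|exact: fd].
rewrite (_ : f = (fun v => f (x + v)) \o (fun w => w - x)); last first.
  by apply/funext => w /=; congr f; rewrite addrCA subrr addr0.
have Dx : is_derive (x + u) 1 (fun w : R => w - x) 1.
  apply: is_derive_eq (is_deriveB (is_derive_id _ _) (is_derive_cst x _ _)) _.
  by rewrite subr0.
rewrite -[limn _]mulr1; apply: is_derive1_comp Dx.
by rewrite addrAC subrr add0r.
Qed.

Lemma has_pseries_derive f x r d :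
  has_pseries f x r d -> has_pseries (f^`())%classic x r (pseries_diffs d).
Proof.
move=> fd; split; first by case: fd.
move=> u ur; have D := has_pseries_is_derive fd ur.
rewrite derive1E derive_val.
have [s us sr] := between_norm ur.
apply: (@is_cvg_pseries_diffs d s) => //.
by apply/cvg_ex; exists (f (x + s)); exact: fd.2.
Qed.

Lemma has_pseriesD f g x r d c : has_pseries f x r d -> has_pseries g x r c ->
  has_pseries (fun v => f v + g v) x r (fun k => d k + c k).
Proof.
move=> [r0 fd] [_ gc]; split=> // u ur.
rewrite (_ : pseries _ u = pseries d u + pseries c u).
  by apply: cvgD; [exact: fd|exact: gc].
apply/funext => k; rewrite fctE /pseries /series /= -big_split /=.
by apply: eq_bigr => i _; rewrite mulrDl.
Qed.

Lemma has_pseriesZ f x r d (a : R) : has_pseries f x r d ->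
  has_pseries (fun v => a * f v) x r (fun k => a * d k).
Proof.
move=> [r0 fd]; split=> // u ur.
rewrite (_ : pseries _ u = (fun k => a * pseries d u k)).
  by apply: cvgMr; exact: fd.
apply/funext => k; rewrite /pseries /series /= mulr_sumr.
by apply: eq_bigr => i _; rewrite mulrA.
Qed.

(** Split v = (v - x) + x: the first summand shifts the coefficients, the second scales them. *)
Lemma has_pseriesX f x r d : has_pseries f x r d ->
  has_pseries (fun v => v * f v) x r
    (fun k => (if k is j.+1 then d j else 0) + x * d k).
Proof.
move=> fd; have [r0 fdu] := fd.
suff S : has_pseries (fun v => (v - x) * f v) x r (fun k => if k is j.+1 then d j else 0).
  have [_ H] := has_pseriesD S (has_pseriesZ x fd); split=> // u ur.
  by have := H u ur; rewrite -mulrDl subrK.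
split=> // u ur; rewrite addrAC subrr add0r; apply: cvg_of_shiftS.
rewrite (_ : (fun k => _) = (fun k => u * pseries d u k)).
  by apply: cvgMr; exact: fdu.
apply/funext => k; rewrite /pseries /series /= big_nat_recl // mul0r add0r mulr_sumr.
by apply: eq_bigr => i _; rewrite exprS mulrCA.
Qed.

Lemma has_pseries_center f x r d : has_pseries f x r d -> f x = d 0%N.
Proof.
move=> [r0 /(_ 0)]; rewrite normr0 addr0 => /(_ r0) fx.
apply: (cvg_unique _ fx) => //; apply: cvg_of_shiftS.
rewrite (_ : (fun k => _) = cst (d 0%N)); first exact: cvg_cst.
apply/funext => k; rewrite /pseries /series /= big_nat_recl // expr0 mulr1.
by rewrite big1 ?addr0 // => i _; rewrite expr0n mulr0.
Qed.

Lemma has_pseries_continuous f x r d : has_pseries f x r d -> {for x, continuous f}.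
Proof.
move=> fd; have [r0 _] := fd.
have := @has_pseries_is_derive _ _ _ _ 0 fd; rewrite normr0 addr0 => /(_ r0)[D _].
by move/derivable1_diffP : D => /differentiable_continuous.
Qed.

Definition zeros_cluster f x :=
  forall s, 0 < s -> exists u, [/\ u != 0, `|u| < s & f (x + u) = 0].

(** Continuity gives f(x) = 0, that is, d_0 = 0. Dividing by v - x shifts the coefficients and keeps
    all zeros other than x, so the argument repeats. *)
Lemma has_pseries_zeros_cluster k f x r d :
  has_pseries f x r d -> zeros_cluster f x -> d k = 0.
Proof.
have base f' d' : has_pseries f' x r d' -> zeros_cluster f' x -> d' 0%N = 0.
  move=> fd az.
  rewrite -(has_pseries_center fd); apply/eqP/negPn/negP => fx0.
  have := has_pseries_continuous fd => /cvgrPdist_lt /(_ `|f' x|).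
  rewrite normr_gt0 => /(_ fx0) /nbhs_ballP[s /= s0 fs].
  have [u [u0 us fu]] := az s s0.
  have /fs : ball x s (x + u) by rewrite /ball /= opprD addrA subrr add0r normrN.
  by rewrite fu subr0 ltxx.
elim: k f d => [|k IH] f d fd az; first exact: base az.
have d0 := base _ _ fd az.
pose g v := if v == x then d 1%N else f v / (v - x).
apply: (IH g (fun j => d j.+1)).
  split; first by case: fd.
  move=> u ur; rewrite /g -subr_eq0 addrAC subrr add0r.
  have [->|u0] := eqVneq u 0.
    apply: cvg_of_shiftS; rewrite (_ : (fun k => _) = cst (d 1%N)); first exact: cvg_cst.
    apply/funext => j; rewrite /pseries /series /= big_nat_recl // expr0 mulr1.
    by rewrite big1 ?addr0 // => i _; rewrite expr0n mulr0.
  rewrite (_ : pseries _ u = (fun j => pseries d u j.+1 / u)).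
    by apply: cvgMl; rewrite cvg_shiftS; exact: fd.2.
  apply/funext => j; rewrite /pseries /series /= big_nat_recl // d0 mul0r add0r.
  by rewrite mulr_suml; apply: eq_bigr => i _; rewrite exprSr mulrA mulfK.
move=> s s0; have [u [u0 us fu]] := az s s0; exists u; split=> //.
by rewrite /g -subr_eq0 addrAC subrr add0r (negPf u0) fu mul0r.
Qed.

Definition analytic f := forall x, x < 1 -> exists r d, has_pseries f x r d.

(* The points near which f vanishes form a clopen subset of ]-oo, 1[. *)
Lemma analytic_eq0 f : analytic f ->
  (\forall x \near (0 : R), f x = 0) -> forall x, x < 1 -> f x = 0.
Proof.
move=> fa f0.
pose I := [set x : R | x < 1].
pose C := [set x : R | \forall y \near x, f y = 0].
have conn : connected I.
  apply/connected_intervalP => a b /= Ia Ib c /andP[_ cb].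
  exact: le_lt_trans cb Ib.
have E : I `&` C = I.
  apply: conn.
  - by exists 0; split => //=; exact: ltr01.
  - exists C => //; rewrite openE => x /= Cx; rewrite /interior.
    exact: nbhs_interior.
  - exists (closure (I `&` C)); first exact: closed_closure.
    apply/seteqP; split => [x [Ix Cx]|x [Ix clx]]; split => //.
      exact: subset_closure.
    have [r [d fd]] := fa x Ix; have [r0 fdu] := fd.
    (* Assuming [~ C x] makes the zeros found near [x] different from [x], as [zeros_cluster]
       requires. *)
    have [//|nCx] := pselect (C x).
    have az : zeros_cluster f x.
      move=> s s0; have [y [[Iy Cy] ys]] := clx _ (nbhsx_ballx x s s0).
      exists (y - x); split.
      - by rewrite subr_eq0; apply/eqP => yx; apply: nCx; rewrite -yx.
      - by rewrite distrC.
      - by rewrite addrCA subrr addr0; exact: nbhs_singleton Cy.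
    have dz k := has_pseries_zeros_cluster k fd az.
    near=> y; have yr : `|y - x| < r by rewrite distrC; near: y; exact: (nbhsx_ballx x r r0).
    have := fdu _ yr; rewrite addrCA subrr addr0 => /cvg_unique; apply=> //.
    rewrite (_ : pseries d _ = cst 0); first exact: cvg_cst.
    apply/funext => k; rewrite /pseries /series /= big1 // => i _.
    by rewrite dz mul0r.
move=> x x1; have [_ Cx] : (I `&` C) x by rewrite E.
exact: nbhs_singleton Cx.
Unshelve. all: by end_near.
Qed.

End LocalPowerSeries.

(** * The differential equation of the hypergeometric function *)

Section HypergeometricEquation.
Variable R : realType.
Implicit Types (f g : R -> R) (d : nat -> R) (x u r b h : R).

Lemma cvg_Re_Im (s : nat -> R[i]) (l : R[i]) : s @ \oo --> (l : R[i]^o) ->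
  (fun k => complex.Re (s k)) @ \oo --> complex.Re l /\
  (fun k => complex.Im (s k)) @ \oo --> complex.Im l.
Proof.
move=> /(@cvgrPdist_lt _ (R[i]^o)) sl; split; apply/cvgrPdist_lt => eps eps0.
  have : (0 : R[i]) < eps%:C by rewrite ltcR.
  move=> /sl; apply: filterS => k; rewrite -ltcR; apply: le_lt_trans.
  by apply: le_trans (normc_ge_Re _); case: l (s k) {sl} => [? ?] [? ?].
have : (0 : R[i]) < eps%:C by rewrite ltcR.
move=> /sl; apply: filterS => k; rewrite -ltcR; apply: le_lt_trans.
(* Multiplication by i preserves the norm and turns the imaginary part, up to sign, into a real
   part, for which the estimate is available. *)
rewrite (_ : `|(l : R[i]^o) - s k| = `|(l - s k) * 'i%C|).
  apply: le_trans (normc_ge_Re _); rewrite ReiNIm normrN.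
  by case: l (s k) {sl} => [? ?] [? ?].
by rewrite normrM [ `|'i%C| ]normc_def /= expr0n expr1n add0r sqrtr1 mulr1.
Qed.

Lemma powser_real (d : nat -> R[i]) x u :
  powser d x%:C (x + u)%:C = (fun k => pseries (fun j => complex.Re (d j)) u k +i*
                                        pseries (fun j => complex.Im (d j)) u k).
Proof.
apply/funext => k; rewrite /powser /pseries /series /=.
have -> : (x + u)%:C - x%:C = u%:C by rewrite rmorphD addrAC subrr add0r.
elim: k => [|k IH]; first by rewrite !big_geq.
rewrite !big_nat_recr //= IH -rmorphXn.
case: (d k) => a c; apply/eqP; rewrite eq_complex /=.
by rewrite !mulr0 subr0 add0r !eqxx.
Qed.

(** It multiplies the k-th Taylor coefficient at 0 by k + b. *)
Definition euler_op b f v := v * (f^`())%classic v + b * f v.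

(** This is (1 - v) g' + (h - 1) g, which annihilates (1 - v)^(h - 1). It is spelled with sums,
    scalings and products by v so that the rules for coefficients apply literally. *)
Definition first_order_op h g v :=
  ((g^`())%classic v + -1 * (v * (g^`())%classic v)) + (h - 1) * g v.

Lemma has_pseries_euler_op b f x r d : has_pseries f x r d ->
  has_pseries (euler_op b f) x r
    (fun k => ((if k is j.+1 then pseries_diffs d j else 0)
               + x * pseries_diffs d k) + b * d k).
Proof.
move=> fd; have X := has_pseriesX (has_pseries_derive fd).
exact: has_pseriesD X (has_pseriesZ b fd).
Qed.

Lemma has_pseries_first_order_op h g x r d : has_pseries g x r d ->
  has_pseries (first_order_op h g) x r
    (fun k => (pseries_diffs d k + -1 * ((if k is j.+1 then pseries_diffs d j else 0)
               + x * pseries_diffs d k)) + (h - 1) * d k).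
Proof.
move=> gd; have D := has_pseries_derive gd; have X := has_pseriesX D.
exact: has_pseriesD (has_pseriesD D (has_pseriesZ (-1) X)) (has_pseriesZ (h - 1) gd).
Qed.

Lemma pochS (a : R) k : poch a k.+1 = poch a k * (a + k%:R).
Proof. by rewrite /poch big_ord_recr. Qed.

(** The reason is (b)_k (k + b) = b (b + 1)_k: the lower parameter cancels. *)
Lemma hyp_coef_contiguous (a b : R) k : hyp_defined a b (b + 1) ->
  (k%:R + b) * hyp_coef a b (b + 1) k = b * poch a k / (k`!)%:R.
Proof.
move=> hd.
have shift : poch b k * (k%:R + b) = b * poch (b + 1) k.
  elim: (k) => [|j IH]; first by rewrite /poch !big_ord0 add0r mulr1 mul1r.
  rewrite !pochS mulrA -IH -natr1; ring.
have fk : (k`!)%:R != 0 :> R by rewrite pnatr_eq0 -lt0n fact_gt0.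
rewrite /hyp_coef; have [c0|c0] := eqVneq (poch (b + 1) k) 0; last first.
  apply: (mulIf c0); apply: (mulIf fk).
  have -> : (k%:R + b) * (poch a k * poch b k / (poch (b + 1) k * k`!%:R)) *
     poch (b + 1) k * k`!%:R = poch a k * (poch b k * (k%:R + b)).
    by field; rewrite fk c0.
  by rewrite shift; field.
(* The coefficient is 0 here because the inverse of 0 is 0. Now b + 1 = -i for some i < k, and
   [hyp_defined] forces (a)_k = 0, since b = -m with m <= i would contradict b = -i - 1. *)
rewrite c0 mul0r invr0 !mulr0.
have /eqP/prodf_eq0[i _ /eqP bi] := c0.
have [m mi] : exists2 m : nat, (m <= i)%N & a = - m%:R \/ b = - m%:R.
  by apply: hd; apply/eqP; rewrite -addr_eq0 bi.
case=> [am|bm].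
  suff -> : poch a k = 0 by rewrite mulr0 mul0r.
  apply/eqP/prodf_eq0.
  by exists (Ordinal (leq_ltn_trans mi (ltn_ord i))); rewrite // am /= addrC subrr.
have /eqP : m%:R = i.+1%:R :> R by rewrite -natr1; lra.
by rewrite eqr_nat => /eqP im; move: mi; rewrite im ltnn.
Qed.

Lemma near0_pseries f r d : has_pseries f 0 r d -> (forall k, d k = 0) ->
  \forall x \near (0 : R), f x = 0.
Proof.
move=> [r0 fd] d0; near=> x.
have xr : `|x| < r by rewrite -normrN -sub0r; near: x; exact: (nbhsx_ballx 0 r r0).
have := fd _ xr; rewrite add0r => /cvg_unique; apply => //.
rewrite (_ : pseries d _ = cst 0); first exact: cvg_cst.
by apply/funext => k; rewrite /pseries /series /= big1 // => i _; rewrite d0 mul0r.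
Unshelve. all: by end_near.
Qed.

(** Along the real line the powers of w - w0 are real, so the real and imaginary parts of an
    expansion are real expansions with coefficients Re d_k and Im d_k. *)
Lemma principal_2F1_analytic (a b c : R) F : principal_2F1 a b c F ->
  analytic (fun x => complex.Re (F x%:C)) /\ analytic (fun x => complex.Im (F x%:C)).
Proof.
move=> [_ _ loc].
have W x : x < 1 -> exists r (d : nat -> R[i]),
    has_pseries (fun x => complex.Re (F x%:C)) x r (fun j => complex.Re (d j)) /\
    has_pseries (fun x => complex.Im (F x%:C)) x r (fun j => complex.Im (d j)).
  move=> x1; have /loc[r [d [r0 fd]]] : slit_plane x%:C.
    by move=> /= [_]; rewrite leNgt x1.
  exists r, d; suff H u : `|u| < r ->
      pseries (fun j => complex.Re (d j)) u @ \oo --> complex.Re (F (x + u)%:C) /\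
      pseries (fun j => complex.Im (d j)) u @ \oo --> complex.Im (F (x + u)%:C).
    by split; split => // u ur; case: (H u ur).
  move=> ur; have /fd : `|(x + u)%:C - x%:C| < r%:C.
    have -> : (x + u)%:C - x%:C = u%:C by rewrite rmorphD addrAC subrr add0r.
    by rewrite normc_def /= expr0n addr0 sqrtr_sqr ltcR.
  by rewrite powser_real => /cvg_Re_Im.
by split=> x /W[r [d [H1 H2]]]; [exists r, (fun j => complex.Re (d j))|exists r, (fun j => complex.Im (d j))].
Qed.

Lemma principal_2F1_at0 (a b c : R) F : principal_2F1 a b c F ->
  has_pseries (fun x => complex.Re (F x%:C)) 0 1 (hyp_coef a b c) /\
  has_pseries (fun x => complex.Im (F x%:C)) 0 1 (fun=> 0).
Proof.
move=> [_ Fd _]; suff H u : `|u| < 1 ->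
    pseries (hyp_coef a b c) u @ \oo --> complex.Re (F (0 + u)%:C) /\
    pseries (fun=> 0) u @ \oo --> complex.Im (F (0 + u)%:C).
  by split; split => // u ur; case: (H u ur).
move=> u1; have /Fd : `|(0 + u)%:C| < 1 :> R[i].
  by rewrite add0r normc_def /= expr0n addr0 sqrtr_sqr -(rmorph1 (real_complex R)) ltcR.
have P : powser (fun k => (hyp_coef a b c k)%:C) 0 (0 + u)%:C = _ :=
  powser_real (fun k => (hyp_coef a b c k)%:C) 0 u.
by rewrite P => /cvg_Re_Im.
Qed.

(* With b = c - 1 the Euler operator turns the series into the binomial series
   of b (1 - w)^(h - 1), which satisfies a first order equation. *)
Lemma principal_2F1_ode h b (F : R[i] -> R[i]) :
  principal_2F1 (1 - h) b (b + 1) F ->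
  exists f : R -> R, (forall x, x < 1 -> F x%:C = (f x)%:C) /\
    forall x, x < 1 -> exists2 df, is_derive x 1 f df &
      x * df + b * f x = b * (1 - x) `^ (h - 1).
Proof.
move=> PF; have [aRe aIm] := principal_2F1_analytic PF.
have [Re0 Im0] := principal_2F1_at0 PF.
exists (fun x => complex.Re (F x%:C)); split.
  (* The series at 0 has real coefficients, so the imaginary part vanishes near 0; the identity
     theorem carries this to ]-oo, 1[. *)
  move=> x x1; have := analytic_eq0 aIm (near0_pseries Im0 (fun=> erefl)) x1.
  by case: (F x%:C) => u v /= ->.
set f := fun x => complex.Re (F x%:C) in aRe Re0 *.
have DS x : x < 1 -> forall g, analytic g -> is_derive x 1 g ((g^`())%classic x).
  move=> x1 g /(_ x x1)[r [d gd]].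
  have := @has_pseries_is_derive _ _ _ _ _ 0 gd; rewrite normr0 addr0 => /(_ gd.1)[D _].
  by rewrite derive1E; exact: derivableP.
pose g := euler_op b f.
have ag : analytic g.
  by move=> x /aRe[r [d fd]]; exists r, (fun k => ((if k is j.+1 then pseries_diffs d j else 0)
     + x * pseries_diffs d k) + b * d k); exact: has_pseries_euler_op.
have aL : analytic (first_order_op h g).
  move=> x /ag[r [d gd]]; exists r, (fun k => (pseries_diffs d k
     + -1 * ((if k is j.+1 then pseries_diffs d j else 0)
     + x * pseries_diffs d k)) + (h - 1) * d k); exact: has_pseries_first_order_op.
have g0 := has_pseries_euler_op b Re0.
have hd : hyp_defined (1 - h) b (b + 1) by case: PF.
pose E k := b * poch (1 - h) k / (k`!)%:R.
have eE : (fun k => ((if k is j.+1 then pseries_diffs (hyp_coef (1 - h) b (b + 1)) j else 0)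
     + 0 * pseries_diffs (hyp_coef (1 - h) b (b + 1)) k) + b * hyp_coef (1 - h) b (b + 1) k) = E.
  apply/funext => k; rewrite /E -hyp_coef_contiguous // mul0r addr0 mulrDl; congr (_ + _).
  by case: k => [|k] //; rewrite mul0r.
rewrite eE in g0.
have L0 : \forall x \near (0 : R), first_order_op h g x = 0.
  apply: near0_pseries (has_pseries_first_order_op h g0) _ => k.
  have fk j : (j`!)%:R != 0 :> R by rewrite pnatr_eq0 -lt0n fact_gt0.
  have ES j : j.+1%:R * E j.+1 = (1 - h + j%:R) * E j.
    have j1 : j.+1%:R != 0 :> R by rewrite pnatr_eq0.
    by rewrite /E pochS factS natrM; move: (j.+1%:R) j1 => y y0; field; rewrite fk y0.
  rewrite mul0r addr0 /pseries_diffs ES.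
  case: k => [|k]; first by ring.
  by rewrite -natr1; ring.
have gE := analytic_eq0 aL L0.
(* The substitution v = 1 - exp(s) maps R onto ]-oo, 1[, so constancy can be tested by a derivative
   on all of R. The constant function [T] is g(v) (1 - v)^(1 - h). *)
have gexp s : g (1 - expR s) = b * expR (s * (h - 1)).
  pose T s := g (1 - expR s) * expR (s * (1 - h)).
  have T0 : T s = T 0.
    apply: is_derive_0_is_cst => t.
    have t1 : 1 - expR t < 1 by rewrite ltrBlDr ltrDl expR_gt0.
    have De : is_derive t 1 (fun t : R => 1 - expR t) (- expR t).
      apply: is_derive_eq (is_deriveB (is_derive_cst (1 : R) t 1) (is_derive_expR t)) _.
      by rewrite sub0r.
    have Dl : is_derive t 1 (fun t : R => t * (1 - h)) (1 - h).
      have := is_deriveM (is_derive_id t 1) (is_derive_cst (1 - h) t 1).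
      by move/is_derive_eq; apply; rewrite scaler0 add0r /GRing.scale /= mulr1.
    have D1 := @is_derive1_comp R g (fun t : R => 1 - expR t) t _ _ (DS _ t1 _ ag) De.
    have D2 := @is_derive1_comp R expR (fun t : R => t * (1 - h)) t _ _ (is_derive_expR _) Dl.
    apply: is_derive_eq (is_deriveM D1 D2) _.
    transitivity (- expR (t * (1 - h)) * first_order_op h g (1 - expR t)); last first.
      by rewrite gE // mulr0.
    rewrite /first_order_op /GRing.scale /=; ring.
  have Tb : T s = b.
    rewrite T0 /T mul0r !expR0 subrr mulr1.
    by rewrite /g (has_pseries_center g0) /E /poch big_ord0 mulr1 fact0 divr1.
  transitivity (T s * expR (s * (h - 1))); last by rewrite Tb.
  by rewrite /T -mulrA -expRD -mulrDr -(opprB h 1) addNr mulr0 expR0 mulr1.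
move=> x x1; exists ((f^`())%classic x); first exact: DS.
have := gexp (ln (1 - x)); rewrite lnK ?posrE ?subr_gt0 // (_ : 1 - (1 - x) = x); last by ring.
rewrite /g /euler_op => ->.
by rewrite /powR gt_eqF ?subr_gt0 // [ln _ * _]mulrC.
Qed.

End HypergeometricEquation.

(** * Monomials and signs in the exterior algebra *)

Section ExteriorAlgebra.
Local Open Scope set_scope.
Local Open Scope ring_scope.
Variables (R : realType) (n : nat).
Implicit Types (S T A B : {set 'I_(n + n)}) (u v w : Defs.form R n).

Definition monomial A : Defs.form R n := [ffun S => (S == A)%:R].

Lemma genE (i : 'I_(n + n)) A : gen R i A = (A == [set i]%SET)%:R.
Proof. by rewrite ffunE. Qed.

Lemma monomialE A S : monomial A S = (S == A)%:R.
Proof. by rewrite ffunE. Qed.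

Lemma fscaleE (c : R[i]) u S : fscale c u S = c * u S.
Proof. by rewrite ffunE. Qed.

Lemma wedgeE u v S : wedge u v S =
  \sum_(A in powerset S) shuffle_sign R A (S :\: A) * u A * v (S :\: A).
Proof. by rewrite ffunE. Qed.

Lemma fconstE (c : R[i]) S : fconst n c S = if S == finset.set0 then c else 0.
Proof. by rewrite ffunE. Qed.

Lemma wedge_gen (i : 'I_(n + n)) v S :
  wedge (gen R i) v S =
  if i \in S then shuffle_sign R [set i]%SET (S :\ i) * v (S :\ i) else 0.
Proof.
rewrite wedgeE; case: ifP => iS.
  rewrite (bigD1 [set i]%SET) ?powersetE ?finset.sub1set //= genE eqxx mulr1 big1 ?addr0 //.
  by move=> A /andP[_ /negPf Ai]; rewrite genE Ai mulr0 mul0r.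
rewrite big1 // => A; rewrite powersetE genE => AS.
have [Ai|] := eqVneq A [set i]%SET; last by rewrite mulr0 mul0r.
by move: AS; rewrite Ai finset.sub1set iS.
Qed.

Lemma wedge_monomial A B (s : R[i]) : (forall x, x \in A -> x \notin B) ->
  wedge (monomial A) (fscale s (monomial B)) =
  fscale (shuffle_sign R A B * s) (monomial (A :|: B)).
Proof.
move=> dAB; apply/ffunP => S; rewrite wedgeE fscaleE monomialE.
have E : (S == A :|: B) = (A \subset S) && (S :\: A == B).
  apply/eqP/andP => [->|[AS /eqP <-]].
    split; first exact: finset.subsetUl.
    apply/eqP/setP => x; rewrite !inE; case: (boolP (x \in A)) => //= xA.
    exact/esym/negbTE/dAB.
  apply/setP => x; rewrite !inE; case: (boolP (x \in A)) => //= xA.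
  by rewrite (fintype.subsetP AS).
rewrite E; case: (boolP (A \subset S)) => AS /=.
  rewrite (bigD1 A) ?powersetE //= fscaleE !monomialE eqxx mulr1 big1 ?addr0.
    by case: eqP => [->|_]; rewrite ?mulr1 ?mulr0 // mulr0.
  by move=> T /andP[_ /negPf TA]; rewrite monomialE TA mulr0 mul0r.
rewrite mulr0 big1 // => T; rewrite powersetE monomialE => TS.
have [TA|] := eqVneq T A; last by rewrite mulr0 mul0r.
by rewrite -TA TS in AS.
Qed.

Lemma shuffle_sign_lt A B :
  (forall i j, i \in A -> j \in B -> (i <= j)%N) -> shuffle_sign R A B = 1.
Proof.
move=> AB; rewrite /shuffle_sign (_ : [set p in _ | _]%SET = finset.set0) ?cards0 //.
apply/setP => -[i j]; rewrite !inE /=; apply/negbTE/negP => /andP[/andP[iA jB]].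
by rewrite ltnNge AB.
Qed.

Lemma sqr_shuffle_sign A B : shuffle_sign R A B * shuffle_sign R A B = 1.
Proof. by rewrite /shuffle_sign -expr2 sqrr_sign. Qed.

(** Only the existence of a sign is claimed, as the sign will enter the theorem squared. *)
Lemma big_wedge_dz_dzbar : exists k : nat,
  \big[@wedge R n/fconst n 1]_(j < n) wedge (dz R j) (dzbar R j) =
  fscale ((-1) ^+ k) (monomial [set: 'I_(n + n)]%SET).
Proof.
pose U (r : seq 'I_n) := ([set i | i \in [seq lshift n j | j <- r]]
                          :|: [set i | i \in [seq rshift n j | j <- r]])%SET.
have [k ->] : exists k : nat, \big[@wedge R n/fconst n 1]_(j < n) wedge (dz R j) (dzbar R j) =
    fscale ((-1) ^+ k) (monomial (U (index_enum 'I_n))).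
  (* The induction runs over a duplicate-free list of indices; freeness from duplicates gives the
     disjointness needed to multiply monomials. *)
  elim: (index_enum _) (index_enum_uniq 'I_n) => [_|j r IH /= /andP[jr /IH[k E]]].
    exists 0%N; rewrite big_nil; apply/ffunP => S; rewrite fconstE fscaleE monomialE expr0 mul1r.
    rewrite (_ : U [::] = finset.set0); first by case: (S == _).
    by apply/setP => i; rewrite !inE.
  have Uj i : i \in [set lshift n j] -> i \notin [set rshift n j].
    by rewrite !inE => /eqP->; rewrite eq_lrshift.
  have -> : \big[@wedge R n/fconst n 1]_(j <- j :: r) wedge (dz R j) (dzbar R j) =
     wedge (wedge (dz R j) (dzbar R j)) (fscale ((-1) ^+ k) (monomial (U r))).
    by rewrite big_cons E.
  have -> : wedge (dz R j) (dzbar R j) = monomial [set lshift n j; rshift n j]%SET.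
    have := wedge_monomial 1 Uj; rewrite shuffle_sign_lt; last first.
      by move=> a b; rewrite !inE => /eqP-> /eqP-> /=; rewrite leq_eqVlt ltn_addr ?orbT.
    have F1 A : fscale 1 (monomial A) = monomial A.
      by apply/ffunP => S; rewrite fscaleE mul1r.
    by rewrite mulr1 !F1.
  rewrite wedge_monomial; last first.
    move=> i; rewrite !inE negb_or => /orP[]/eqP->.
      rewrite mem_map ?jr /=; last exact: lshift_inj.
      by apply/negP => /mapP[l _ /eqP]; rewrite eq_lrshift.
    rewrite andbC mem_map ?jr /=; last exact: rshift_inj.
    by apply/negP => /mapP[l _ /eqP]; rewrite eq_rlshift.
  exists (#|[set p in finset.setX [set lshift n j; rshift n j] (U r) | (p.2 < p.1)%N]%SET| + k)%N.
  rewrite exprD /shuffle_sign; congr (fscale _ (monomial _)).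
  apply/setP => i; rewrite !inE /=.
  by case: (i == lshift n j); case: (i == rshift n j); case: (i \in map _ r).
exists k; congr (fscale _ (monomial _)); apply/setP => i; rewrite !inE.
by case: (split_ordP i) => j ->; apply/orP; [left|right]; apply: map_f; rewrite mem_index_enum.
Qed.

Lemma bidegree01 A : #|[set j : 'I_n | lshift n j \in A]%SET| = 0%N ->
  #|[set j : 'I_n | rshift n j \in A]%SET| = 1%N ->
  exists k, A = [set rshift n k]%SET.
Proof.
move=> /eqP; rewrite cards_eq0 => /eqP/setP A0 /eqP/cards1P[k /setP A1].
exists k; apply/setP => i; case: (split_ordP i) => j ->.
  by have := A0 j; rewrite !inE => ->; rewrite eq_lrshift.
by have := A1 j; rewrite !inE => ->; rewrite (inj_eq (@rshift_inj _ _)).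
Qed.

Lemma bidegree00 A : #|[set j : 'I_n | lshift n j \in A]%SET| = 0%N ->
  #|[set j : 'I_n | rshift n j \in A]%SET| = 0%N -> A = finset.set0.
Proof.
move=> /eqP; rewrite cards_eq0 => /eqP/setP A0 /eqP.
rewrite cards_eq0 => /eqP/setP A1; apply/setP => i.
case: (split_ordP i) => j ->; first by have := A0 j; rewrite !inE.
by have := A1 j; rewrite !inE.
Qed.


End ExteriorAlgebra.

(** * The Hodge operator in bidegrees (0, 1) and (n, n) *)

Section HodgeOperator.
Local Open Scope set_scope.
Local Open Scope ring_scope.
Variables (R : realType) (n : nat).
Implicit Types (S T A B : {set 'I_(n + n)}) (u v w : Defs.form R n).
Implicit Type M : 'M[R[i]]_(n + n).

Lemma set_minor1 M (i j : 'I_(n + n)) : set_minor M [set i] [set j] = M i j.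
Proof.
(* The size [#|[set i]|] equals 1 only propositionally, so the determinant is evaluated for a
   variable size. *)
have det1 m (A : 'M[R[i]]_m) (k : 'I_m) : m = 1%N -> \det A = A k k.
  by move=> m1; subst m; rewrite det_mx11 (ord1 k).
rewrite /set_minor; have k : 'I_#|[set i]| by rewrite cards1; exact: ord0.
rewrite (det1 _ _ k) ?cards1 // !mxE.
have /set1P -> := enum_valP k; rewrite enum_set1; congr (M i _).
by case: k => k /=; rewrite cards1 ltnS leqn0 => /eqP ->.
Qed.

(** Rows and columns are permuted alike, so the two signs cancel. *)
Lemma det_reindex m N (A : 'M[R[i]]_N) (f : 'I_m -> 'I_N) :
  m = N -> injective f -> \det (\matrix_(i, j) A (f i) (f j)) = \det A.
Proof.
move=> mN; subst m => fi; pose s := perm fi.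
have -> : (\matrix_(i, j) A (f i) (f j)) = row_perm s (col_perm s A).
  by apply/matrixP => i j; rewrite !mxE !permE.
by rewrite row_permE col_permE !det_mulmx !det_perm odd_permV mulrC -mulrA -expr2 sqrr_sign mulr1.
Qed.

Lemma set_minorT M : set_minor M [set: 'I_(n + n)] [set: 'I_(n + n)] = \det M.
Proof.
rewrite /set_minor.
transitivity (\det (\matrix_(i, j) M (enum_val i) (enum_val j) :
    'M[R[i]]_#|[set: 'I_(n + n)]|)).
  congr (\det _); apply/matrixP => i j; rewrite !mxE; congr (M _ _).
  exact/esym/enum_val_nth.
by apply: det_reindex; [rewrite cardsT card_ord|exact: enum_val_inj].
Qed.

(** The inner product of the monomial e_S with [v]. *)
Definition herm_row M v S : R[i] :=
  \sum_(T : {set 'I_(n + n)} | #|T| == #|S|) conjc (v T) * set_minor M S T.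

Lemma herm_formE M u v : herm_form M u v = \sum_S u S * herm_row M v S.
Proof.
apply: eq_bigr => S _; rewrite /herm_row mulr_sumr.
by apply: eq_bigr => T _; rewrite mulrA.
Qed.

Lemma herm_row1 M v (i : 'I_(n + n)) :
  herm_row M v [set i] = \sum_(j < n + n) conjc (v [set j]) * M i j.
Proof.
rewrite /herm_row cards1.
transitivity (\sum_(T in [set [set j] | j : 'I_(n + n)]) conjc (v T) * set_minor M [set i] T).
  apply: eq_bigl => T; apply/cards1P/imsetP => [[j ->]|[j _ ->]]; exists j => //.
rewrite big_imset /=; last by move=> x y _ _ /set1_inj.
by apply: eq_big => // j _; rewrite set_minor1.
Qed.

Lemma herm_rowT M v :
  herm_row M v [set: 'I_(n + n)] = conjc (v [set: 'I_(n + n)]) * \det M.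
Proof.
rewrite /herm_row (big_pred1 [set: 'I_(n + n)]) ?set_minorT // => T /=.
apply/idP/idP => [|/eqP-> //]; rewrite eqEcard finset.subsetT => /eqP->.
by rewrite leqnn.
Qed.

Definition vol_sign : R[i] :=
  (\big[@wedge R n/fconst n 1]_(j < n) wedge (dz R j) (dzbar R j)) [set: 'I_(n + n)].

Lemma vol_signE :
  \big[@wedge R n/fconst n 1]_(j < n) wedge (dz R j) (dzbar R j) =
  fscale vol_sign (monomial R [set: 'I_(n + n)]).
Proof.
rewrite /vol_sign; have [k ->] := big_wedge_dz_dzbar R n.
by rewrite fscaleE monomialE eqxx mulr1.
Qed.

Lemma vol_sign_conj : conjc vol_sign = vol_sign.
Proof.
rewrite /vol_sign; have [k ->] := big_wedge_dz_dzbar R n.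
by rewrite fscaleE monomialE eqxx mulr1 rmorphXn rmorphN rmorph1.
Qed.

Lemma sqr_vol_sign : vol_sign * vol_sign = 1.
Proof.
rewrite /vol_sign; have [k ->] := big_wedge_dz_dzbar R n.
by rewrite fscaleE monomialE eqxx mulr1 -expr2 sqrr_sign.
Qed.

Variables (G : 'M[int]_(2 + n)) (b : 'M[R]_(n, 2 + n)) (z : 'rV[R[i]]_n).

Definition vol_coef : R[i] := vol_sign * (4 * 'i%C * (qY G b z)%:C) ^- n.

Lemma volE : vol G b z = fscale vol_coef (monomial R [set: 'I_(n + n)]).
Proof.
rewrite /vol vol_signE; apply/ffunP => S; rewrite !fscaleE /vol_coef.
by rewrite mulrA [vol_sign * _]mulrC.
Qed.

(** For n > 0 these index the monomials of bidegree (n, n-1). *)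
Definition hat (k : 'I_n) : {set 'I_(n + n)} := [set: 'I_(n + n)] :\ rshift n k.

Lemma hat_inj : injective hat.
Proof.
move=> j k /setP /(_ (rshift n k)); rewrite !inE eqxx /= andbT.
by move=> /negbFE /eqP /rshift_inj.
Qed.

Definition hat_sign (k : 'I_n) : R[i] := shuffle_sign R [set rshift n k] (hat k).

Lemma bidegree_hat A : (0 < n)%N -> #|[set j : 'I_n | lshift n j \in A]| = n ->
  #|[set j : 'I_n | rshift n j \in A]| = n.-1 -> exists k, A = hat k.
Proof.
move=> n0 A1 A2.
have [k Ak] : exists k, ~: A = [set rshift n k].
  apply: bidegree01.
    have := cardsC [set j : 'I_n | lshift n j \in A].
    rewrite A1 card_ord -[in RHS](addn0 n) => /addnI <-.
    by apply: eq_card => j; rewrite !inE.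
  have := cardsC [set j : 'I_n | rshift n j \in A].
  rewrite A2 card_ord -[in RHS](prednK n0) -[in RHS]addn1 => /addnI <-.
  by apply: eq_card => j; rewrite !inE.
by exists k; rewrite /hat -[A]finset.setCK Ak finset.setTD.
Qed.

Lemma card_hat k : #|[set j : 'I_n | lshift n j \in hat k]| = n /\
  #|[set j : 'I_n | rshift n j \in hat k]| = n.-1.
Proof.
split.
  rewrite -[RHS]card_ord -cardsT; apply: eq_card => j.
  by rewrite !inE eq_lrshift.
have /(congr1 predn) /= := cardsD1 k [set: 'I_n].
rewrite inE cardsT card_ord => ->.
by apply: eq_card => j; rewrite !inE (inj_eq (@rshift_inj _ _)).
Qed.

Lemma bidegree_eq0 p q u S : has_bidegree p q u ->
  ~ (#|[set j : 'I_n | lshift n j \in S]| = p /\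
     #|[set j : 'I_n | rshift n j \in S]| = q) -> u S = 0.
Proof. by move=> hu nS; apply/eqP/negPn/negP => /hu. Qed.

(** Obtained by solving the defining equation for u = d\bar z_k: the wedge of d\bar z_k with the
    monomial on [hat k] is [hat_sign k] times the full monomial, and this sign is its own
    inverse. *)
Definition barstar01 v : Defs.form R n := [ffun S => \sum_(k < n) (S == hat k)%:R *
  (hat_sign k * herm_row (cometric G b z) v [set rshift n k] * vol_coef)].

Lemma barstar01_hat v k : barstar01 v (hat k) =
  hat_sign k * herm_row (cometric G b z) v [set rshift n k] * vol_coef.
Proof.
rewrite ffunE (bigD1 k) //= eqxx mul1r big1 ?addr0 // => j /negPf jk.
by rewrite (inj_eq hat_inj) eq_sym jk mul0r.
Qed.

(** As [barstar] chooses by [xget], both existence and uniqueness are needed. Positivity of n keeps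
    the truncated [n - 1] the true complementary degree. *)
Lemma barstar01P v : (0 < n)%N -> barstar G b 0 1 z v = barstar01 v.
Proof.
move=> n0; apply: xget_unique.
  split.
    move=> S; rewrite subn0 subn1 => wS.
    have [k ->] : exists k, S = hat k.
      apply: contrapT => nk; move/eqP: wS; apply; rewrite ffunE big1 // => k _.
      by case: eqP => [E|_]; rewrite ?mul0r //; case: nk; exists k.
    exact: card_hat.
  move=> u hu; apply/ffunP => S; rewrite wedgeE volE !fscaleE monomialE.
  rewrite /herm herm_formE !mulr_suml big_mkcond; apply: eq_bigr => A _.
  have [uA|] := eqVneq (u A) 0; first by rewrite uA !(mulr0, mul0r); case: ifP.
  move=> /hu[/bidegree01 /[apply] -[k Ak]].
  rewrite powersetE; case: ifP => AS; last first.
    case: eqP AS => [->|_ _]; first by rewrite finset.subsetT.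
    by rewrite !mulr0.
  have [ST|ST] := eqVneq S [set: 'I_(n + n)].
    have := sqr_shuffle_sign R [set rshift n k] (hat k).
    rewrite ST Ak -/(hat k) barstar01_hat -/(hat_sign k) mulr1.
    move: (hat_sign k) (u _) (herm_row _ _ _) vol_coef => s x h c ss.
    by transitivity (s * s * (x * h * c)); [ring|rewrite ss mul1r].
  (* If S is not the full set, no term survives: removing an element [rshift n k] of S could leave
     [hat j] only for j = k and S full. *)
  rewrite !mulr0 ffunE big1 ?mulr0 // => j _; case: eqP => [E|_]; rewrite ?mul0r //.
  case/eqP: ST; apply/setP => i; have /setP /(_ i) := E.
  rewrite Ak !inE andbT; have [->|ij] := eqVneq i (rshift n k).
    have : (rshift n k) \in S by rewrite -finset.sub1set -Ak.
    by move=> ->.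
  move=> /= ->.
  apply/eqP => ij'; have /setP /(_ (rshift n k)) := E.
  rewrite Ak !inE eqxx /= andbT => /esym /negbFE /eqP kj.
  by rewrite ij' kj eqxx in ij.
move=> w [hw wv]; apply/ffunP => S.
have [[k ->]|nk] := pselect (exists k, S = hat k); last first.
  rewrite ffunE big1; last first.
    by move=> k _; case: eqP => [E|_]; rewrite ?mul0r //; case: nk; exists k.
  apply: (bidegree_eq0 hw); rewrite subn0 subn1 => -[S1 S2]; apply: nk.
  exact: bidegree_hat.
rewrite barstar01_hat.
(* Uniqueness: testing against d\bar z_k isolates the coefficient on [hat k]. *)
have hk : has_bidegree 0 1 (dzbar R k).
  move=> A; rewrite genE; case: (A =P _) => [-> _|_]; last by rewrite eqxx.
  split; last first.
    by apply/eqP/cards1P; exists k; apply/setP => j; rewrite !inE (inj_eq (@rshift_inj _ _)).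
  by apply/eqP; rewrite cards_eq0; apply/eqP/setP => j; rewrite !inE eq_lrshift.
have /ffunP /(_ [set: 'I_(n + n)]) := wv _ hk.
rewrite wedge_gen inE volE !fscaleE monomialE eqxx mulr1 -/(hat k) -/(hat_sign k).
rewrite /herm herm_formE (bigD1 [set rshift n k]) //= genE eqxx mul1r big1 ?addr0.
  move=> E; rewrite -mulrA -E mulrA sqr_shuffle_sign mul1r //.
by move=> A /negPf Ak; rewrite genE Ak mul0r.
Qed.

(** The full monomial is the only one of bidegree (n, n), so the defining identity is a single
    scalar equation, with the determinant of the whole cometric as its Gram matrix. *)
Lemma barstarnnP v : barstar G b n n z v =
  fconst n (conjc (v [set: 'I_(n + n)]) * \det (cometric G b z) * vol_coef).
Proof.
have topP A : #|[set j : 'I_n | lshift n j \in A]| = n ->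
    #|[set j : 'I_n | rshift n j \in A]| = n -> A = [set: 'I_(n + n)].
  move=> A1 A2; rewrite -[A]finset.setCK (_ : ~: A = finset.set0) ?finset.setC0 //.
  apply: bidegree00.
    have := cardsC [set j : 'I_n | lshift n j \in A].
    rewrite A1 card_ord -[in RHS](addn0 n) => /addnI <-.
    by apply: eq_card => j; rewrite !inE.
  have := cardsC [set j : 'I_n | rshift n j \in A].
  rewrite A2 card_ord -[in RHS](addn0 n) => /addnI <-.
  by apply: eq_card => j; rewrite !inE.
have wedgeT u w S : has_bidegree n n u -> has_bidegree 0 0 w ->
    wedge u w S = (S == [set: 'I_(n + n)])%:R * (u [set: 'I_(n + n)] * w finset.set0).
  move=> hu hw; rewrite wedgeE.
  have [->|ST] := eqVneq S [set: 'I_(n + n)].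
    rewrite (bigD1 [set: 'I_(n + n)]) ?powersetE ?finset.subsetT //= big1 ?addr0.
      by rewrite finset.setDv shuffle_sign_lt ?mul1r // => i j; rewrite !inE.
    move=> A /andP[_ AT]; have [->|/hu[A1 A2]] := eqVneq (u A) 0.
      by rewrite mulr0 mul0r.
    by move: AT; rewrite (topP A A1 A2) eqxx.
  rewrite mul0r big1 // => A; rewrite powersetE => AS.
  have [->|/hu[A1 A2]] := eqVneq (u A) 0; first by rewrite mulr0 mul0r.
  by move: AS ST; rewrite (topP A A1 A2) finset.subTset => ->.
have hT : has_bidegree n n (monomial R [set: 'I_(n + n)]).
  move=> A; rewrite monomialE; case: (A =P _) => [-> _|_]; last by rewrite eqxx.
  by split; rewrite -[RHS]card_ord -cardsT; apply: eq_card => j; rewrite !inE.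
have hermT u : has_bidegree n n u -> herm G b z u v =
    u [set: 'I_(n + n)] * (conjc (v [set: 'I_(n + n)]) * \det (cometric G b z)).
  move=> hu; rewrite /herm herm_formE (bigD1 [set: 'I_(n + n)]) //= herm_rowT big1 ?addr0 //.
  move=> A AT; have [->|/hu[A1 A2]] := eqVneq (u A) 0; first by rewrite mul0r.
  by move: AT; rewrite (topP A A1 A2) eqxx.
apply: xget_unique.
  rewrite subnn; have h0 c : has_bidegree 0 0 (fconst n (c : R[i])).
    move=> A; rewrite fconstE; case: (A =P _) => [-> _|_]; last by rewrite eqxx.
    by split; apply/eqP; rewrite cards_eq0; apply/eqP/setP => j; rewrite !inE.
  split=> // u hu; apply/ffunP => S.
  rewrite wedgeT // fconstE eqxx hermT // volE !fscaleE monomialE.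
  by rewrite mulrC !mulrA.
move=> w [hw wv]; rewrite subnn in hw.
apply/ffunP => S; rewrite fconstE; case: eqP => [->|S0]; last first.
  by apply: (bidegree_eq0 hw) => -[S1 S2]; apply: S0; exact: bidegree00.
have /ffunP /(_ [set: 'I_(n + n)]) := wv _ hT.
by rewrite wedgeT // hermT // volE !fscaleE monomialE eqxx !mul1r mulr1.
Qed.

End HodgeOperator.

(** * Algebra of the bilinear form *)

Section BilinearForm.
Variables (N : nat) (G : 'M[int]_N).

Section OverField.
Variable F : fieldType.
Implicit Types (x y w : 'rV[F]_N) (a : F).

Lemma bilDl x y w : bil G (x + y) w = bil G x w + bil G y w.
Proof. by rewrite /bil !mulmxDl mxE. Qed.

Lemma bilDr x y w : bil G w (x + y) = bil G w x + bil G w y.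
Proof. by rewrite /bil linearD mulmxDr mxE. Qed.

Lemma bilZl a x w : bil G (a *: x) w = a * bil G x w.
Proof. by rewrite /bil -!scalemxAl mxE. Qed.

Lemma bilZr a x w : bil G w (a *: x) = a * bil G w x.
Proof. by rewrite /bil linearZ /= -scalemxAr mxE. Qed.

Lemma bilNl x w : bil G (- x) w = - bil G x w.
Proof. by rewrite -scaleN1r bilZl mulN1r. Qed.

Lemma bilNr x w : bil G w (- x) = - bil G w x.
Proof. by rewrite -scaleN1r bilZr mulN1r. Qed.

Lemma bil0l w : bil G 0 w = 0.
Proof. by rewrite -(scale0r 0) bilZl mul0r. Qed.

Lemma bil_suml (I : Type) (r : seq I) (f : I -> 'rV[F]_N) w :
  bil G (\sum_(i <- r) f i) w = \sum_(i <- r) bil G (f i) w.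
Proof.
elim: r => [|i r IH]; first by rewrite !big_nil bil0l.
by rewrite !big_cons bilDl IH.
Qed.

Lemma bilC : G^T = G -> forall x y, bil G x y = bil G y x.
Proof.
move=> GT x y; rewrite /bil.
have -> : y *m map_mx intr G *m x^T = (x *m map_mx intr G *m y^T)^T.
  by rewrite !trmx_mul trmxK map_trmx GT mulmxA.
by rewrite [in RHS]mxE.
Qed.

End OverField.

Lemma bil_toC (R : realType) (x y : 'rV[R]_N) :
  bil G (toC x) (toC y) = (bil G x y)%:C.
Proof.
rewrite /bil /toC map_trmx.
rewrite (_ : map_mx intr G = map_mx (real_complex R) (map_mx intr G)).
  by rewrite -!map_mxM mxE.
by apply/matrixP => i j; rewrite !mxE rmorph_int.
Qed.

End BilinearForm.

(** * Consequences of the signature (2, n) *)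

Section Signature.
Variables (R : realType) (n : nat) (G : 'M[int]_(2 + n)).
Hypothesis GT : G^T = G.
Hypothesis hsig : signature_2n R G.

(* A vector of positive norm orthogonal to a positive definite plane would span
   with it a positive definite 3-space, which meets the negative definite
   n-space of the signature. *)
Lemma orthogonal_positive_plane (x y v : 'rV[R]_(2 + n)) :
  0 < bil G x x -> 0 < bil G y y -> bil G x y = 0 ->
  bil G v x = 0 -> bil G v y = 0 -> bil G v v <= 0.
Proof.
move=> xx yy xy vx vy; rewrite leNgt; apply/negP => vv.
have [P Pu PG] := hsig.
pose c (u : 'rV[R]_(2 + n)) : 'rV[R]_(2 + n) := u *m invmx P.
have bilE u : lsubmx (c u) = 0 -> bil G u u <= 0.
  move=> l0; rewrite /bil -[u](mulmxKV Pu) -/(c u) trmx_mul !mulmxA.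
  rewrite -[c u *m P *m _ *m _]mulmxA -(mulmxA (c u)) (mulmxA P) PG.
  rewrite -[c u]hsubmxK l0 mul_row_block !mul0mx !mulmx0 !add0r ?addr0.
  rewrite tr_row_mx mul_row_col mul0mx add0r mulmxN mulmx1 mulNmx mxE oppr_le0.
  by rewrite mxE; apply: sumr_ge0 => i _; rewrite [(_)^T _ _]mxE -expr2 sqr_ge0.
(* The left block of [c u] holds the two positive coordinates of [u]. Three rows of length 2 are
   dependent, so some combination of x, y, v has no positive coordinates. *)
pose A := col_mx (col_mx (lsubmx (c x)) (lsubmx (c y))) (lsubmx (c v)).
have : kermx A != 0.
  rewrite -mxrank_eq0 mxrank_ker -lt0n subn_gt0.
  exact: leq_ltn_trans (rank_leq_col _) _.
case/rowV0Pn => w /sub_kermxP wA w0.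
have [w1 [w2 [w3 [wE wlin]]]] : exists w1 w2 w3 : R,
    (w = row_mx (row_mx w1%:M w2%:M) w3%:M) /\
    lsubmx (c (w1 *: x + w2 *: y + w3 *: v)) = 0.
  exists (lsubmx (lsubmx w) 0 0), (rsubmx (lsubmx w) 0 0), (rsubmx w 0 0).
  split; first by rewrite -!mx11_scalar !hsubmxK.
  rewrite /c !mulmxDl !linearD /= -!scalemxAl !linearZ /= -!mul_scalar_mx -!mx11_scalar.
  by move: wA; rewrite -{1}[w]hsubmxK -{1}[lsubmx w]hsubmxK !mul_row_col.
have := bilE _ wlin.
rewrite !(bilDl, bilDr, bilZl, bilZr) xy vx vy (bilC GT y x) xy (bilC GT x v) vx.
rewrite (bilC GT y v) vy !mulr0 !addr0 !add0r => le0.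
have p1 : 0 <= w1 * (w1 * bil G x x) by rewrite mulrA -expr2 mulr_ge0 ?sqr_ge0 ?ltW.
have p2 : 0 <= w2 * (w2 * bil G y y) by rewrite mulrA -expr2 mulr_ge0 ?sqr_ge0 ?ltW.
have p3 : 0 <= w3 * (w3 * bil G v v) by rewrite mulrA -expr2 mulr_ge0 ?sqr_ge0 ?ltW.
have z (a t : R) : 0 < t -> a * (a * t) = 0 -> a = 0.
  by move=> t0 /eqP; rewrite mulrA -expr2 mulf_eq0 sqrf_eq0 (gt_eqF t0) orbF => /eqP.
have z1 : w1 = 0 by apply: z xx _; lra.
have z2 : w2 = 0 by apply: z yy _; lra.
have z3 : w3 = 0 by apply: z vv _; lra.
by move: w0; rewrite wE z1 z2 z3 !raddf0 !row_mx0 eqxx.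
Qed.

Lemma gram_unitmx : (map_mx intr G : 'M[R]_(2 + n)) \in unitmx.
Proof.
have [P Pu PG] := hsig.
have : P *m map_mx intr G *m P^T \in unitmx.
  by rewrite PG unitmxE det_ublock det1 mul1r -scaleN1r detZ det1 mulr1 unitrX // unitrN unitr1.
by rewrite !unitmx_mul Pu unitmx_tr Pu andbT.
Qed.

End Signature.

(** * Complex conjugation and finite sums *)

Section Conjugation.
Variable R : realType.
Implicit Types x y : R[i].

Lemma conjcD x y : (x + y)^* = x^* + y^*. Proof. exact: rmorphD. Qed.
Lemma conjcB x y : (x - y)^* = x^* - y^*. Proof. exact: rmorphB. Qed.
Lemma conjcM x y : (x * y)^* = x^* * y^*. Proof. exact: rmorphM. Qed.
Lemma conjcX x k : (x ^+ k)^* = (x^*) ^+ k. Proof. exact: rmorphXn. Qed.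

Lemma conjcInvol x : x^*^* = x. Proof. exact: conjcK. Qed.
Lemma conjcInv x : (x^-1)^* = (x^*)^-1. Proof. exact: fmorphV. Qed.
Lemma conjcZero : (0 : R[i])^* = 0. Proof. exact: rmorph0. Qed.
Lemma conjcNat k : (k%:R : R[i])^* = k%:R. Proof. exact: rmorph_nat. Qed.
Lemma conjcR (a : R) : (a%:C)^* = a%:C.
Proof. by apply/eqP; rewrite eq_complex /= oppr0 !eqxx. Qed.

Lemma conjc_sum (I : Type) (r : seq I) (f : I -> R[i]) :
  (\sum_(i <- r) f i)^* = \sum_(i <- r) (f i)^*.
Proof. exact: rmorph_sum. Qed.

Lemma Re_sum (I : Type) (r : seq I) (f : I -> R[i]) :
  complex.Re (\sum_(i <- r) f i) = \sum_(i <- r) complex.Re (f i).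
Proof. by apply: (big_morph (@complex.Re R)) => // -[? ?] [? ?]. Qed.

Lemma Im_sum (I : Type) (r : seq I) (f : I -> R[i]) :
  complex.Im (\sum_(i <- r) f i) = \sum_(i <- r) complex.Im (f i).
Proof. by apply: (big_morph (@complex.Im R)) => // -[? ?] [? ?]. Qed.

End Conjugation.

(** * Geometry of psi(Z) and of the projections of lam *)

Section TubeGeometry.
Variables (R : realType) (n : nat) (G : 'M[int]_(2 + n)).
Variables (e : 'rV[int]_(2 + n)) (e' : 'rV[R]_(2 + n)) (b : 'M[R]_(n, 2 + n)).
Hypothesis GT : G^T = G.
Hypothesis hsig : signature_2n R G.
Hypothesis heq : quad G (latR R e) = 0.
Hypothesis hee' : bil G (latR R e) e' = 1.
Hypothesis hb : orthogonal_basis_K G e e' b.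
Implicit Types (lam : 'rV[R]_(2 + n)) (z : 'rV[R[i]]_n).

Definition ksign (j : 'I_n) : R := if val j == 0%N then 1 else - 1.

Lemma sqr_ksign j : ksign j * ksign j = 1.
Proof. by rewrite /ksign; case: ifP; rewrite ?mulrNN mulr1. Qed.

Lemma quad2 (F : numFieldType) (x : 'rV[F]_(2 + n)) : bil G x x = 2 * quad G x.
Proof. by rewrite /quad mulrC divfK // pnatr_eq0. Qed.

Let E := latR R e.
Let Et := etilde G e e'.

Lemma bil_ee : bil G E E = 0.
Proof. by rewrite quad2 heq mulr0. Qed.

Lemma bil_e_etilde : bil G E Et = 1.
Proof. by rewrite /Et /etilde bilDr bilNr bilZr bil_ee hee' mulr0 subr0. Qed.

(** The correction of e' by -q(e') e serves this purpose: [e] and [etilde] form a hyperbolic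
    pair. *)
Lemma bil_etilde2 : bil G Et Et = 0.
Proof.
rewrite {1}/Et /etilde bilDl bilNl bilZl bil_e_etilde mulr1.
by rewrite /Et /etilde bilDr bilNr bilZr (bilC GT e') hee' mulr1 quad2; ring.
Qed.

Lemma bil_row_e j : bil G (row j b) E = 0 /\ bil G (row j b) e' = 0.
Proof.
have [_ hK _ _] := hb.
have [m [k [a [kK ->]]]] := (hK (row j b)).2 (row_sub j b).
by split; rewrite bil_suml big1 // => i _; rewrite bilZl; case: (kK i) => h1 h2;
  rewrite ?h1 ?h2 mulr0.
Qed.

Lemma bil_row_etilde j : bil G (row j b) Et = 0.
Proof.
have [h1 h2] := bil_row_e j.
by rewrite /Et /etilde bilDr bilNr bilZr h1 h2 mulr0 subr0.
Qed.

Lemma bil_row_row j k : bil G (row j b) (row k b) = if j == k then 2 * ksign j else 0.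
Proof.
have [_ _ h1 h2] := hb; case: eqVneq => [->|/h1 //].
by rewrite quad2 h2.
Qed.

Lemma bil_sumr (F : fieldType) (I : Type) (r : seq I) (f : I -> 'rV[F]_(2 + n)) w :
  bil G w (\sum_(i <- r) f i) = \sum_(i <- r) bil G w (f i).
Proof. by rewrite (bilC GT) bil_suml; apply: eq_bigr => i _; rewrite (bilC GT). Qed.

(** Stated over a general field because it is applied both to the real vector Y and to the complex
    vector Z. *)
Lemma quad_sum (F : numFieldType) (v : 'I_n -> 'rV[F]_(2 + n)) (s : 'I_n -> F) (c : 'I_n -> F) :
  (forall j k, bil G (v j) (v k) = if j == k then 2 * s j else 0) ->
  quad G (\sum_j c j *: v j) = \sum_j s j * c j ^+ 2.
Proof.
move=> vv; apply: (mulfI (_ : 2 != 0)); first by rewrite pnatr_eq0.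
rewrite -quad2 bil_suml mulr_sumr; apply: eq_bigr => j _.
rewrite bil_sumr (bigD1 j) //= big1 ?addr0 => [|k kj]; rewrite bilZl bilZr vv.
  by rewrite eqxx; ring.
by rewrite eq_sym (negPf kj) !mulr0.
Qed.

Lemma ZvecE z : Zvec b z = \sum_j z 0 j *: toC (row j b).
Proof.
rewrite /Zvec mulmx_sum_row; apply: eq_bigr => j _; congr (_ *: _).
by apply/rowP => k; rewrite !mxE.
Qed.

Lemma YvecE z : Yvec b z = \sum_j complex.Im (z 0 j) *: row j b.
Proof.
apply/rowP => k; rewrite mxE ZvecE !summxE Im_sum; apply: eq_bigr => j _.
by rewrite !mxE; case: (z 0 j) => u v /=; rewrite mulr0 add0r.
Qed.

Lemma qYE z : qY G b z = \sum_j ksign j * complex.Im (z 0 j) ^+ 2.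
Proof. by rewrite /qY YvecE; apply: quad_sum => j k; exact: bil_row_row. Qed.

Lemma quad_Zvec z : quad G (Zvec b z) = \sum_j (ksign j)%:C * z 0 j ^+ 2.
Proof.
rewrite ZvecE; apply: quad_sum => j k; rewrite bil_toC bil_row_row.
by case: eqP => // _; rewrite rmorphM rmorph_nat.
Qed.

Lemma lam_psiE lam z : lam_psi G e e' b lam z =
  \sum_j (bil G lam (row j b))%:C * z 0 j
  - (bil G lam E)%:C * (\sum_j (ksign j)%:C * z 0 j ^+ 2) + (bil G lam Et)%:C.
Proof.
rewrite /lam_psi /psi 2!bilDr bilNr bilZr !bil_toC [_ * (bil _ _ _)%:C]mulrC quad_Zvec ZvecE bil_sumr.
rewrite -/E -/Et; congr (_ - _ + _).
by apply: eq_bigr => j _; rewrite bilZr bil_toC mulrC.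
Qed.

Lemma lam_psi_conj lam z :
  lam_psi G e e' b lam (map_mx conjc z) = (lam_psi G e e' b lam z)^*.
Proof.
rewrite !lam_psiE conjcD conjcB conjcM !conjcR !conjc_sum.
congr (_ - _ * _ + _); apply: eq_bigr => j _; rewrite conjcM conjcR ?conjcX mxE //.
Qed.

Lemma bil_psi2 z : bil G (psi G e e' b z) (psi G e e' b z) = 0.
Proof.
have Ze : bil G (Zvec b z) (toC E) = 0.
  rewrite ZvecE bil_suml big1 // => j _.
  by rewrite bilZl bil_toC (bil_row_e j).1 mulr0.
have Zt : bil G (Zvec b z) (toC Et) = 0.
  rewrite ZvecE bil_suml big1 // => j _.
  by rewrite bilZl bil_toC bil_row_etilde mulr0.
rewrite /psi !(bilDl, bilDr, bilNl, bilNr, bilZl, bilZr) -/E -/Et.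
rewrite (bilC GT (toC E) (Zvec b z)) (bilC GT (toC Et) (Zvec b z)) Ze Zt.
rewrite (bilC GT (toC Et) (toC E)) !bil_toC bil_ee bil_e_etilde bil_etilde2.
by rewrite quad2 rmorph1 rmorph0; ring.
Qed.

Lemma row_Re_Im (w : 'rV[R[i]]_(2 + n)) :
  w = toC (map_mx (@complex.Re R) w) + 'i%C *: toC (map_mx (@complex.Im R) w).
Proof.
by apply/rowP => k; rewrite !mxE; exact: complexE.
Qed.

Lemma psiYE z : psiY G e e' b z =
  Yvec b z - complex.Im (quad G (Zvec b z)) *: E.
Proof.
rewrite /psiY /psi /Yvec; move: (quad G (Zvec b z)) (etilde G e e') => q t.
move: (Zvec b z) => w.
apply/rowP => k; rewrite !mxE; case: (w 0 k) q => u v [c d] /=.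
by ring.
Qed.

(** Since psi(Z) is isotropic, its real and imaginary parts are orthogonal and of equal norm. That
    norm is the one of Y, because psi(Y) - Y is a multiple of the isotropic vector [e], which is
    orthogonal to Y. *)
Lemma bil_psiXY z :
  [/\ bil G (psiX G e e' b z) (psiX G e e' b z) = 2 * qY G b z,
      bil G (psiY G e e' b z) (psiY G e e' b z) = 2 * qY G b z &
      bil G (psiX G e e' b z) (psiY G e e' b z) = 0].
Proof.
have YY : bil G (psiY G e e' b z) (psiY G e e' b z) = 2 * qY G b z.
  have Ye : bil G (Yvec b z) E = 0.
    rewrite YvecE bil_suml big1 // => j _.
    by rewrite bilZl (bil_row_e j).1 mulr0.
  rewrite psiYE !(bilDl, bilDr, bilNl, bilNr, bilZl, bilZr) (bilC GT E) Ye bil_ee.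
  by rewrite -quad2; ring.
have := bil_psi2 z; rewrite [psi _ _ _ _ _]row_Re_Im -/(psiX G e e' b z) -/(psiY G e e' b z).
rewrite !(bilDl, bilDr, bilZl, bilZr) !bil_toC (bilC GT (psiY _ _ _ _ _)) YY.
set u := bil G (psiX G e e' b z) (psiX G e e' b z).
set v := bil G (psiX G e e' b z) (psiY G e e' b z).
move=> /eqP; rewrite eq_complex /= => /andP[/eqP H1 /eqP H2].
by split => //; lra.
Qed.

Lemma lam_psi_XY lam z : lam_psi G e e' b lam z =
  bil G lam (psiX G e e' b z) +i* bil G lam (psiY G e e' b z).
Proof.
rewrite /lam_psi [psi _ _ _ _ _]row_Re_Im bilDr bilZr !bil_toC.
by rewrite [RHS]complexE.
Qed.

Definition projplus lam z : 'rV[R]_(2 + n) :=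
  (bil G lam (psiX G e e' b z) / (2 * qY G b z)) *: psiX G e e' b z +
  (bil G lam (psiY G e e' b z) / (2 * qY G b z)) *: psiY G e e' b z.

Lemma projplus_orthogonal lam z : 0 < qY G b z ->
  bil G (lam - projplus lam z) (psiX G e e' b z) = 0 /\
  bil G (lam - projplus lam z) (psiY G e e' b z) = 0.
Proof.
move=> Q0; have [XX YY XY] := bil_psiXY z.
have Q2 : 2 * qY G b z != 0 by rewrite mulf_neq0 ?pnatr_eq0 // gt_eqF.
rewrite /projplus !(bilDl, bilNl, bilZl) (bilC GT (psiY _ _ _ _ _) (psiX _ _ _ _ _)).
rewrite XX YY XY !mulr0 addr0 add0r !divfK // !subrr; by [].
Qed.

Lemma sub_Zminus z v : (v <= Zminus G e e' b z)%MS <->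
  bil G v (psiX G e e' b z) = 0 /\ bil G v (psiY G e e' b z) = 0.
Proof.
set X := psiX G e e' b z; set Y := psiY G e e' b z.
have bil0 u : bil G v u = 0 <-> v *m map_mx intr G *m u^T = 0.
  rewrite /bil; split=> [h|->]; last by rewrite mxE.
  by apply/matrixP => i j; rewrite !ord1 h mxE.
rewrite /Zminus sub_kermx mulmxA; split.
  move=> /eqP v0.
  have H u : (u <= Zplus G e e' b z)%MS -> bil G v u = 0.
    by move=> /submxP[D ->]; apply/bil0; rewrite trmx_mul mulmxA v0 mul0mx.
  by split; apply: H; [exact: addsmxSl|exact: addsmxSr].
move=> [/bil0 vX /bil0 vY]; apply/eqP.
have /submxP[D ->] : (Zplus G e e' b z <= col_mx X Y)%MS by rewrite /Zplus addsmxE.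
by rewrite trmx_mul mulmxA tr_col_mx mul_mx_row vX vY row_mx0 mul0mx.
Qed.

Lemma Zplus_Zminus z : 0 < qY G b z ->
  (Zplus G e e' b z :&: Zminus G e e' b z = 0)%MS.
Proof.
move=> Q0; have [XX YY XY] := bil_psiXY z.
apply/eqP/rowV0P => v; rewrite sub_capmx => /andP[].
rewrite /Zplus => /sub_addsmxP[[d1 d2] /= ->] /sub_Zminus[].
rewrite [d1]mx11_scalar [d2]mx11_scalar !mul_scalar_mx !(bilDl, bilZl).
rewrite (bilC GT (psiY _ _ _ _ _) (psiX _ _ _ _ _)) XX YY XY !mulr0 addr0 add0r.
have Q2 : 2 * qY G b z != 0 by rewrite mulf_neq0 ?pnatr_eq0 // gt_eqF.
move=> /eqP; rewrite mulf_eq0 (negPf Q2) orbF => /eqP -> /eqP.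
by rewrite mulf_eq0 (negPf Q2) orbF => /eqP ->; rewrite !scale0r addr0.
Qed.

(** The maps [proj_mx] are determined by any decomposition along the two subspaces, so it suffices
    that the explicit summands of [lam] lie in them. *)
Lemma lamplusE lam z : 0 < qY G b z ->
  lamplus G e e' b lam z = projplus lam z /\
  lamminus G e e' b lam z = lam - projplus lam z.
Proof.
move=> Q0; have cap := Zplus_Zminus Q0.
have pP : (projplus lam z <= Zplus G e e' b z)%MS.
  by rewrite /projplus addmx_sub_adds // scalemx_sub.
have mM : (lam - projplus lam z <= Zminus G e e' b z)%MS.
  by apply/sub_Zminus; exact: projplus_orthogonal.
split.
  rewrite /lamplus -{1}[lam](subrK (projplus lam z)) mulmxDl.
  by rewrite (proj_mx_0 cap mM) add0r (proj_mx_id cap pP).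
rewrite capmxC in cap.
rewrite /lamminus -{1}[lam](subrK (projplus lam z)) mulmxDl.
by rewrite (proj_mx_0 cap pP) addr0 (proj_mx_id cap mM).
Qed.

Lemma quad_lamplus lam z : 0 < qY G b z -> quad G (lamplus G e e' b lam z) =
  (complex.Re (lam_psi G e e' b lam z) ^+ 2 + complex.Im (lam_psi G e e' b lam z) ^+ 2)
  / (4 * qY G b z).
Proof.
move=> Q0; rewrite (lamplusE lam Q0).1 lam_psi_XY /=.
have [XX YY XY] := bil_psiXY z.
rewrite /quad /projplus !(bilDl, bilDr, bilZl, bilZr).
rewrite (bilC GT (psiY _ _ _ _ _) (psiX _ _ _ _ _)) XX YY XY.
by field; rewrite gt_eqF.
Qed.

Lemma quad_lamminus lam z : 0 < qY G b z -> quad G (lamminus G e e' b lam z) =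
  quad G lam - quad G (lamplus G e e' b lam z).
Proof.
move=> Q0; have [-> ->] := lamplusE lam Q0.
have [mX mY] := projplus_orthogonal lam Q0.
set p := projplus lam z; have mp : bil G (lam - p) p = 0.
  by rewrite {2}/p /projplus bilDr !bilZr mX mY !mulr0 addr0.
have lp : bil G lam p = bil G p p.
  by apply/eqP; rewrite -subr_eq0 -bilNl -bilDl mp.
clearbody p.
by rewrite /quad !(bilDl, bilDr, bilNl, bilNr) (bilC GT p lam) lp; ring.
Qed.

Lemma quad_lamminus_le0 lam z : 0 < qY G b z -> quad G (lamminus G e e' b lam z) <= 0.
Proof.
move=> Q0; rewrite (lamplusE lam Q0).2.
have [mX mY] := projplus_orthogonal lam Q0; have [XX YY XY] := bil_psiXY z.
have Q2 : 0 < 2 * qY G b z by rewrite mulr_gt0.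
rewrite /quad ler_pdivrMr // mul0r.
by apply: (orthogonal_positive_plane GT hsig (x := psiX G e e' b z) (y := psiY G e e' b z));
  rewrite ?XX ?YY.
Qed.

Lemma quad_coord lam : quad G lam =
  \sum_j ksign j * bil G lam (row j b) ^+ 2 / 4 + bil G lam E * bil G lam Et.
Proof.
(* The error of the expected expansion of [lam]: [e] and [etilde] are dual to each other, and (b_j,
   b_j) = 2 eps_j accounts for the factor eps_j / 2. *)
pose mu := lam - (bil G lam Et *: E + bil G lam E *: Et
  + \sum_j (ksign j * bil G lam (row j b) / 2) *: row j b).
have sE : bil G (\sum_j (ksign j * bil G lam (row j b) / 2) *: row j b) E = 0.
  by rewrite bil_suml big1 // => j _; rewrite bilZl (bil_row_e j).1 mulr0.
have sEt : bil G (\sum_j (ksign j * bil G lam (row j b) / 2) *: row j b) Et = 0.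
  by rewrite bil_suml big1 // => j _; rewrite bilZl bil_row_etilde mulr0.
have sb k : bil G (\sum_j (ksign j * bil G lam (row j b) / 2) *: row j b) (row k b)
    = bil G lam (row k b).
  rewrite bil_suml (bigD1 k) //= big1 ?addr0 => [|j jk]; rewrite bilZl bil_row_row.
    rewrite eqxx; transitivity (ksign k * ksign k * bil G lam (row k b)); first by field.
    by rewrite sqr_ksign mul1r.
  by rewrite (negPf jk) mulr0.
have tE : bil G Et E = 1 by rewrite (bilC GT) bil_e_etilde.
have mE : bil G mu E = 0.
  by rewrite /mu bilDl bilNl !bilDl !bilZl sE bil_ee tE; ring.
have mEt : bil G mu Et = 0.
  by rewrite /mu bilDl bilNl !bilDl !bilZl sEt bil_e_etilde bil_etilde2; ring.
have mb k : bil G mu (row k b) = 0.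
  rewrite /mu bilDl bilNl !bilDl !bilZl sb (bilC GT E) (bil_row_e k).1.
  by rewrite (bilC GT Et) bil_row_etilde; ring.
pose B := col_mx (col_mx E Et) b : 'M[R]_(1 + 1 + n, 2 + n).
have bmu u : (u <= B)%MS -> bil G mu u = 0.
  move=> /submxP[D ->]; rewrite -[D]hsubmxK -[lsubmx D]hsubmxK !mul_row_col.
  rewrite [lsubmx (lsubmx D)]mx11_scalar [rsubmx (lsubmx D)]mx11_scalar !mul_scalar_mx.
  rewrite !bilDr !bilZr mE mEt !mulr0 !add0r mulmx_sum_row bil_sumr big1 // => j _.
  by rewrite bilZr mb mulr0.
(* [B] has 2 + n rows, so independence makes it span the whole space; a vector orthogonal to
   everything is 0 because the Gram matrix is invertible. *)
have Bfree : row_free B.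
  apply/row_freeP; rewrite -/(1 + 1)%N.
  have inj (D : 'rV[R]_(1 + 1 + n)) : D *m B = 0 -> D = 0.
    rewrite -[D]hsubmxK -[lsubmx D]hsubmxK !mul_row_col.
    rewrite [lsubmx (lsubmx D)]mx11_scalar [rsubmx (lsubmx D)]mx11_scalar !mul_scalar_mx.
    set d1 := lsubmx (lsubmx D) 0 0; set d2 := rsubmx (lsubmx D) 0 0 => D0.
    have rb x : bil G (rsubmx D *m b) x = \sum_j rsubmx D 0 j * bil G (row j b) x.
      by rewrite mulmx_sum_row bil_suml; apply: eq_bigr => j _; rewrite bilZl.
    have rE : bil G (rsubmx D *m b) E = 0.
      by rewrite rb big1 // => j _; rewrite (bil_row_e j).1 mulr0.
    have rEt : bil G (rsubmx D *m b) Et = 0.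
      by rewrite rb big1 // => j _; rewrite bil_row_etilde mulr0.
    have d20 : d2 = 0.
      have := congr1 (fun u => bil G u E) D0.
      by rewrite !bilDl !bilZl bil_ee tE rE bil0l mulr0 add0r addr0 mulr1.
    have d10 : d1 = 0.
      have := congr1 (fun u => bil G u Et) D0.
      by rewrite !bilDl !bilZl bil_e_etilde bil_etilde2 rEt bil0l mulr0 !addr0 mulr1.
    move: D0; rewrite d10 d20 !scale0r !add0r => /eqP D0.
    have [bf _ _ _] := hb.
    have -> : rsubmx D = 0.
      by apply: (row_free_inj bf); rewrite mul0mx; apply/eqP.
    by rewrite !raddf0 !row_mx0.
  apply/row_freeP; rewrite -kermx_eq0; apply/rowV0P => D /sub_kermxP.
  exact: inj.
have mu0 : mu = 0.
  have all u : bil G mu u = 0.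
    apply: bmu; apply: submx_full.
    by rewrite /row_full; move: Bfree; rewrite /row_free => /eqP ->.
  have : mu *m map_mx intr G = 0.
    apply/rowP => j; have := all (delta_mx 0 j).
    by rewrite /bil trmx_delta -colE !mxE => ->.
  move/(congr1 (mulmx^~ (invmx (map_mx intr G)))); rewrite mulmxK ?(gram_unitmx hsig) //.
  by rewrite mul0mx.
have L : lam = bil G lam Et *: E + bil G lam E *: Et
    + \sum_j (ksign j * bil G lam (row j b) / 2) *: row j b.
  by apply/eqP; rewrite -subr_eq0; apply/eqP.
rewrite {1}/quad {2}L 2!bilDr 2!bilZr bil_sumr.
apply: (mulIf (_ : 2 != 0)); first by rewrite pnatr_eq0.
rewrite divfK ?pnatr_eq0 // mulrDl mulr_suml addrC; congr (_ + _); last by ring.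
by apply: eq_bigr => j _; rewrite bilZr; field.
Qed.

End TubeGeometry.

(** * The radial factor phi and its equation *)

Section RadialEquation.
Variable R : realType.
Implicit Types (f : R -> R) (h q s x : R) (k : int).

(** The factors of [ptilde] that depend on Z only through s = q(lam_(Z^+)), with q(lam_(Z^-))
    replaced by q - s. *)
Definition radial h q k f s : R :=
  (4 ^ (k + 1) * (k%:~R - h) * ((s - q) `^ (h - 1) * (q - s)))^-1
  * s `^ (h - k%:~R) * f (q / s).

Lemma radial_ode h q k f s df : k%:~R - h != 0 -> 0 < s -> q < s ->
  is_derive (q / s) 1 f df ->
  q / s * df + (k%:~R - h) * f (q / s) = (k%:~R - h) * (1 - q / s) `^ (h - 1) ->
  exists2 dphi, is_derive s 1 (radial h q k f) dphi &
    h * radial h q k f s + (s - q) * dphi = 4 ^ (- k - 1) * s ^ (- k).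
Proof.
set be := k%:~R - h => be0 s0 qs Df ode.
have m0 : 0 < s - q by rewrite subr_gt0.
pose c : R := - (4 ^ (k + 1) * be)^-1.
(* For x > q the factor q - x is -(x - q) and merges with (x - q)^(h - 1); its sign is the one in
   [c]. *)
have radE x : q < x -> radial h q k f x = c * ((x - q) `^ (- h) * x `^ (- be) * f (q / x)).
  move=> qx; have mx : 0 < x - q by rewrite subr_gt0.
  rewrite /radial -/be (_ : h - k%:~R = - be); last by rewrite opprB.
  have -> : (x - q) `^ (- h) = ((x - q) `^ (h - 1) * (x - q))^-1.
    rewrite powRN -{3}(powRr1 (ltW mx)) -powRD ?subrK //.
    by rewrite (gt_eqF mx) implybT.
  rewrite -[q - x]opprB mulrN mulrN invrN /c !invfM; ring.
have D1 : is_derive s 1 (fun x => x - q) 1.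
  apply: is_derive_eq (is_deriveB (is_derive_id _ _) (is_derive_cst q _ _)) _.
  by rewrite subr0.
have D2 := @is_derive1_comp R (fun y => y `^ (- h)) (fun x => x - q) s _ _
  (is_derive1_powR (- h) m0) D1.
have D3 := is_derive1_powR (- be) s0.
have D4 : is_derive s 1 (fun x => q / x) (- q / s ^+ 2).
  have := is_deriveM (is_derive_cst q s 1) (is_derive_invr (lt0r_neq0 s0) (is_derive_id s 1)).
  by move/is_derive_eq; apply; rewrite scaler0 addr0 /GRing.scale /= mulr1 mulrN mulNr.
have D5 := @is_derive1_comp R f (fun x => q / x) s _ _ Df D4.
have D := is_deriveM (is_derive_cst c s 1) (is_deriveM (is_deriveM D2 D3) D5).
eexists.
  apply: near_eq_is_derive D.
  have : \forall x \near s, q < x by exact: lt_nbhsr.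
  apply: filterS => x qx.
  by rewrite radE.
have sp a : s `^ (a - 1) = s `^ a / s.
  by rewrite powRB ?powRr1 ?ltW // (gt_eqF s0) implybT.
have mp a : (s - q) `^ (a - 1) = (s - q) `^ a / (s - q).
  by rewrite powRB ?powRr1 ?ltW // (gt_eqF m0) implybT.
rewrite radE // /GRing.scale /= !fctE /= !sp !mp.
set u := (s - q) `^ (- h); set v := s `^ (- be); set F0 := f (q / s).
have u0 : u != 0 by rewrite gt_eqF // powR_gt0.
(* Since 1 - q / s = (s - q) / s, the right-hand side of the equation becomes a product of powers of
   s - q and s. *)
have key : q / s * df + be * F0 = be * (u^-1 / (s - q) * (s `^ h)^-1 * s).
  rewrite ode; congr (_ * _).
  have -> : 1 - q / s = (s - q) / s by field; rewrite gt_eqF.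
  rewrite powRM ?invr_ge0 ?ltW // mp /u powRN invrK -[RHS]mulrA; congr (_ * _ ).
  by rewrite -[s^-1]powR_inv1 ?ltW // -powRrM mulN1r powRN sp invfM invrK.
have vE : v = s `^ h / s ^ k.
  rewrite /v /be opprB powRB ?powR_intmul ?ltW // (gt_eqF s0) implybT //.
have sk0 : s ^ k != 0 by rewrite expfz_neq0 // gt_eqF.
have sh0 : s `^ h != 0 by rewrite gt_eqF // powR_gt0.
have k40 : (4 : R) ^ (k + 1) != 0 by rewrite expfz_neq0 // pnatr_eq0.
have -> : (4 : R) ^ (- k - 1) = (4 ^ (k + 1))^-1 by rewrite -opprD invr_expz.
rewrite -invr_expz.
(* Differentiating (x - q)^(-h) contributes -h times [radial], which cancels the first summand; the
   rest contains the left-hand side of the hypergeometric equation. *)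
transitivity (- c * u * (s - q) * v / s * (q / s * df + be * F0)).
  by field; rewrite !gt_eqF.
rewrite key vE /c; field.
by rewrite ?sk0 ?sh0 ?u0 ?be0 ?k40 ?(gt_eqF s0) ?(gt_eqF m0).
Qed.

End RadialEquation.

(** * The Kaehler metric and its inverse in coordinates *)

Section KahlerMetric.
Variables (R : realType) (n : nat) (G : 'M[int]_(2 + n)).
Variables (e : 'rV[int]_(2 + n)) (e' : 'rV[R]_(2 + n)) (b : 'M[R]_(n, 2 + n)).
Hypothesis GT : G^T = G.
Hypothesis hb : orthogonal_basis_K G e e' b.
Implicit Types (lam : 'rV[R]_(2 + n)) (z : 'rV[R[i]]_n).

Lemma sum_delta (F : pzSemiRingType) (j : 'I_n) (f : 'I_n -> F) :
  \sum_k (k == j)%:R * f k = f j.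
Proof.
rewrite (bigD1 j) //= eqxx mul1r big1 ?addr0 // => k /negPf->.
by rewrite mul0r.
Qed.

Definition ycoord z (k : 'I_n) : R[i] := (complex.Im (z 0 k))%:C.

Let eps (k : 'I_n) : R[i] := (ksign R k)%:C.

Lemma sqr_eps k : eps k * eps k = 1.
Proof. by rewrite /eps -rmorphM sqr_ksign rmorph1. Qed.

Lemma has_wirtinger_ycoord j k z : has_wirtinger j (fun z => ycoord z k) z
  ((k == j)%:R * (- 'i%C / 2)) ((k == j)%:R * ('i%C / 2)).
Proof.
have Dz := has_wirtinger_coord j k z.
have := has_wirtingerZ ('i%C / 2) (has_wirtingerD (has_wirtinger_conj Dz) (has_wirtingerN Dz)).
rewrite (_ : (fun z => _) = (fun z => ycoord z k)); last first.
  by apply/funext => z'; rewrite /ycoord ImJ_sub; ring.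
move=> /has_wirtinger_eq; apply.
  by rewrite conjcZero; ring.
by rewrite conjcNat; ring.
Qed.

Lemma qY_ycoord z : (qY G b z)%:C = \sum_k eps k * ycoord z k ^+ 2.
Proof.
rewrite (qYE GT hb) rmorph_sum; apply: eq_bigr => k _.
by rewrite rmorphM rmorphXn.
Qed.

Lemma has_wirtinger_qY j z : has_wirtinger j (fun z => (qY G b z)%:C) z
  (- ('i%C * eps j * ycoord z j)) ('i%C * eps j * ycoord z j).
Proof.
have := has_wirtinger_sum (index_enum 'I_n) (fun k =>
  has_wirtingerZ (eps k) (has_wirtingerX 1 (has_wirtinger_ycoord j k z))).
rewrite (_ : (fun z => _) = (fun z => (qY G b z)%:C)); last first.
  by apply/funext => z'; rewrite qY_ycoord.
move=> /has_wirtinger_eq; apply.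
  transitivity (\sum_k (k == j)%:R * (- ('i%C * eps k * ycoord z k))); last exact: sum_delta.
  by apply: eq_bigr => k _; rewrite expr1; field.
transitivity (\sum_k (k == j)%:R * ('i%C * eps k * ycoord z k)); last exact: sum_delta.
by apply: eq_bigr => k _; rewrite expr1; field.
Qed.

Definition lam_psi_partial lam z (j : 'I_n) : R[i] :=
  (bil G lam (row j b))%:C - 2 * (bil G lam (latR R e))%:C * eps j * z 0 j.

Lemma has_wirtinger_lam_psi lam j z :
  has_wirtinger j (lam_psi G e e' b lam) z (lam_psi_partial lam z j) 0.
Proof.
rewrite (_ : lam_psi G e e' b lam = fun z =>
  \sum_k ((bil G lam (row k b))%:C * z 0 k
     + - ((bil G lam (latR R e))%:C * eps k) * z 0 k ^+ 2)
  + (bil G lam (etilde G e e'))%:C); last first.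
  apply/funext => z'; rewrite (lam_psiE GT hb) big_split /=; congr (_ + _ + _).
  by rewrite mulr_sumr -sumrN; apply: eq_bigr => k _; rewrite mulNr mulrA.
have D := has_wirtinger_sum (index_enum 'I_n) (fun k => has_wirtingerD
  (has_wirtingerZ (bil G lam (row k b))%:C (has_wirtinger_coord j k z))
  (has_wirtingerZ (- ((bil G lam (latR R e))%:C * eps k))
     (has_wirtingerX 1 (has_wirtinger_coord j k z)))).
apply: has_wirtinger_eq (has_wirtingerD D (has_wirtinger_cst _ _ _)) _ _.
  rewrite addr0.
  transitivity (\sum_k (k == j)%:R * ((bil G lam (row k b))%:C
     - 2 * (bil G lam (latR R e))%:C * eps k * z 0 k)); last exact: sum_delta.
  by apply: eq_bigr => k _; rewrite expr1; ring.
by rewrite addr0 big1 // => k _; rewrite !mulr0 addr0.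
Qed.

Lemma form_sumE (I : Type) (r : seq I) (F : I -> Defs.form R n) S :
  (\sum_(i <- r) F i) S = \sum_(i <- r) F i S.
Proof. by apply: (big_morph (fun u : Defs.form R n => u S)) => [u v|]; rewrite ffunE. Qed.

Lemma delbar_fconst (f : 'rV[R[i]]_n -> R[i]) z (k : 'I_n) :
  delbar (fun z => fconst n (f z)) z [set rshift n k]%SET = d_zbar k f z.
Proof.
rewrite /delbar form_sumE (bigD1 k) //= big1 ?addr0 => [|j jk]; last first.
  by rewrite wedge_gen inE (inj_eq (@rshift_inj _ _)) (negPf jk).
rewrite wedge_gen inE eqxx finset.setDv shuffle_sign_lt ?mul1r; last first.
  by move=> i j _; rewrite inE.
rewrite ffunE; congr (d_zbar k _ z); apply/funext => z'.
by rewrite fconstE eqxx.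
Qed.

Lemma del_lrshift (w : 'rV[R[i]]_n -> Defs.form R n) z (j k : 'I_n) :
  del w z [set lshift n j; rshift n k]%SET = d_z j (fun z' => w z' [set rshift n k]%SET) z.
Proof.
rewrite /del form_sumE (bigD1 j) //= big1 ?addr0 => [|l lj]; last first.
  by rewrite wedge_gen !inE (inj_eq (@lshift_inj _ _)) (negPf lj) eq_lrshift.
rewrite wedge_gen !inE eqxx /=.
have -> : ([set lshift n j; rshift n k] :\ lshift n j = [set rshift n k])%SET.
  apply/setP => i; rewrite !inE; have [->|_] := eqVneq i (lshift n j) => //=.
  by rewrite eq_lrshift.
rewrite shuffle_sign_lt ?mul1r ?ffunE // => i l; rewrite !inE => /eqP-> /eqP->.
by rewrite /= leq_eqVlt ltn_addr ?orbT.
Qed.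

Lemma metricE z j k : 0 < qY G b z -> metric G b z j k =
  eps j * eps k * ycoord z j * ycoord z k / (2 * (qY G b z)%:C ^+ 2)
  - (j == k)%:R * eps j / (4 * (qY G b z)%:C).
Proof.
move=> Q0; have QC0 z' : 0 < qY G b z' -> (qY G b z')%:C != 0.
  by move=> Q0'; rewrite fmorph_eq0 gt_eqF.
rewrite mxE /kahler fscaleE del_lrshift.
have dlog z' : 0 < qY G b z' ->
    d_zbar k (fun z => (ln (qY G b z))%:C) z' = 'i%C * eps k * ycoord z' k / (qY G b z')%:C.
  move=> Q0'; rewrite (d_zbar_wirtinger (has_wirtinger_real_comp (has_wirtinger_qY k z')
     (is_derive1_ln Q0'))).
  by rewrite fmorphV mulrC.
have Dq := has_wirtinger_qY j z.
have D : has_wirtinger j (fun z' => 'i%C * eps k * ycoord z' k / (qY G b z')%:C) z _ _ :=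
  has_wirtingerM (has_wirtingerZ ('i%C * eps k) (has_wirtinger_ycoord j k z))
    (has_wirtingerV (QC0 z Q0) Dq).
(* The inner derivative has its closed form only on the tube, where [ln] is differentiable, so the
   outer one is transported along Q > 0. *)
have := has_wirtinger_eq_pos Dq Q0 Dq Q0 _ D => /(_ (fun z' =>
  delbar (fun z' => fconst n (ln (qY G b z'))%:C) z' [set rshift n k]%SET)).
move=> /(_ _)/d_z_wirtinger -> => [|z' Q0' _]; last by rewrite delbar_fconst dlog.
have i0 : 'i%C != 0 :> R[i] by rewrite eq_complex /= oner_eq0 andbF.
have ii := sqr_iC R.
have -> : (k == j)%:R = (j == k)%:R :> R[i] by rewrite eq_sym.
have jk : (j == k)%:R * eps k = (j == k)%:R * eps j.
  by have [->|] := eqVneq j k; rewrite ?mul0r.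
move: jk (QC0 z Q0); set d := _%:R; set ej := eps j; set ek := eps k.
move: (ycoord z j) (ycoord z k) (qY G b z)%:C => yj yk q jk q0.
transitivity (('i%C * 'i%C) * (d * ek / (4 * q)) - ('i%C * 'i%C) * (ej * ek * yj * yk / (2 * q ^+ 2))).
  by field; rewrite q0 i0.
by rewrite ii jk; ring.
Qed.

Definition cometric_coef z (k l : 'I_n) : R[i] :=
  8 * ycoord z k * ycoord z l - 4 * (qY G b z)%:C * (k == l)%:R * eps k.

(** The metric is -diag(eps) / (4 Q) plus a rank-one term, so its inverse is given by the
    Sherman-Morrison formula; the denominator there is 1 - 2 = -1 because sum_k eps_k y_k^2 = Q. *)
Lemma metric_cometric z : 0 < qY G b z ->
  metric G b z *m (\matrix_(k, l) cometric_coef z k l) = 1%:M.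
Proof.
move=> Q0; have q0 : (qY G b z)%:C != 0 by rewrite fmorph_eq0 gt_eqF.
apply/matrixP => j k; rewrite !mxE.
set q := (qY G b z)%:C in q0 *.
have qE : q = \sum_k eps k * ycoord z k ^+ 2 := qY_ycoord z.
transitivity (\sum_l ((4 * eps j * ycoord z j * ycoord z k / q ^+ 2) * (eps l * ycoord z l ^+ 2)
     + (l == j)%:R * ((l == k)%:R * eps j * eps l - 2 * eps j / q * ycoord z l * ycoord z k)
     + (l == k)%:R * (- (2 * eps j * (eps l * eps l) * ycoord z j * ycoord z l / q)))).
  apply: eq_bigr => l _; rewrite metricE // -/q [X in _ * X]mxE /cometric_coef -/q.
  by rewrite (eq_sym j l); field.
rewrite !big_split /= -mulr_sumr -qE !sum_delta sqr_eps.
have -> : (j == k)%:R * eps j * eps j = (j == k)%:R by rewrite -mulrA sqr_eps mulr1.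
by field.
Qed.

Lemma invmx_metric z : 0 < qY G b z ->
  invmx (metric G b z) = \matrix_(k, l) cometric_coef z k l.
Proof.
move=> Q0; have H := metric_cometric Q0; have [Mu _] := mulmx1_unit H.
by rewrite -[RHS]mul1mx -(mulVmx Mu) -mulmxA H mulmx1.
Qed.

Lemma cometric_coef_sym z k l : cometric_coef z k l = cometric_coef z l k.
Proof.
rewrite /cometric_coef; rewrite (eq_sym l k); case: (k =P l) => [->//|_] /=.
by rewrite !mulr0 !mul0r; ring.
Qed.

Lemma cometric_coef_conj z k l : (cometric_coef z k l)^* = cometric_coef z k l.
Proof.
by rewrite /cometric_coef conjcB !conjcM !conjcR !conjcNat.
Qed.

(** The inverse metric is real and symmetric, so the transposition and conjugation in [cometric]
    have no effect and both blocks agree. *)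
Lemma cometric_block z : 0 < qY G b z -> cometric G b z =
  block_mx (\matrix_(k, l) cometric_coef z k l) 0 0 (\matrix_(k, l) cometric_coef z k l).
Proof.
move=> Q0; rewrite /cometric invmx_metric //; congr (block_mx _ 0 0 _).
  by apply/matrixP => k l; rewrite !mxE cometric_coef_sym.
apply/matrixP => k l; rewrite !mxE.
exact: etrans (cometric_coef_conj z l k) (cometric_coef_sym z l k).
Qed.

(** Only the square of det H is needed. The metric is itself D H D / (16 Q^2) with D = diag(eps), so
    taking determinants in metric H = 1 yields it without computing det H. *)
Lemma det_cometric z : 0 < qY G b z -> \det (cometric G b z) = (4 * (qY G b z)%:C) ^+ (2 * n).
Proof.
move=> Q0; rewrite cometric_block // det_ublock.
set H : 'M[R[i]]_n := \matrix_(k, l) _.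
have q0 : (qY G b z)%:C != 0 by rewrite fmorph_eq0 gt_eqF.
pose D : 'M[R[i]]_n := diag_mx (\row_j eps j).
have MD : metric G b z = (16 * (qY G b z)%:C ^+ 2)^-1 *: (D *m H *m D).
  apply/matrixP => j k; rewrite metricE // mul_mx_diag mul_diag_mx !mxE /cometric_coef.
  have [->|jk] := eqVneq j k; last by rewrite /= !mulr0n; field.
  have e2 := sqr_eps k.
  transitivity ((eps k * eps k * ycoord z k * ycoord z k / (2 * (qY G b z)%:C ^+ 2))
    - (eps k * eps k) * eps k / (4 * (qY G b z)%:C)); first by rewrite e2 /= mulr1n; ring.
  by rewrite /= mulr1n; field.
have dD : \det D * \det D = 1.
  rewrite det_diag -big_split big1 //= => k _.
  by rewrite !mxE sqr_eps.
have := congr1 determinant (metric_cometric Q0); rewrite det_mulmx det1 -/H MD.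
rewrite detZ !det_mulmx => E.
have q16 : (16 * (qY G b z)%:C ^+ 2) ^+ n != 0.
  by rewrite expf_neq0 // mulf_neq0 ?pnatr_eq0 // expf_neq0.
rewrite mulnC mulnC exprM (_ : (4 * _) ^+ 2 = 16 * (qY G b z)%:C ^+ 2); last by ring.
apply: (mulfI (_ : (16 * (qY G b z)%:C ^+ 2) ^- n != 0)); first by rewrite invr_neq0.
rewrite mulVf // -[RHS]E exprVn.
transitivity ((\det D * \det D) * ((16 * (qY G b z)%:C ^+ 2) ^- n * (\det H * \det H))).
  by rewrite dD mul1r.
by ring.
Qed.

End KahlerMetric.

(** * The form pZ, its divergence, and the conjugate derivatives of ptilde *)

Section PolarPart.
Variables (R : realType) (n : nat) (G : 'M[int]_(2 + n)).
Variables (e : 'rV[int]_(2 + n)) (e' : 'rV[R]_(2 + n)) (b : 'M[R]_(n, 2 + n)).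
Hypothesis GT : G^T = G.
Hypothesis hsig : signature_2n R G.
Hypothesis heq : quad G (latR R e) = 0.
Hypothesis hee' : bil G (latR R e) e' = 1.
Hypothesis hb : orthogonal_basis_K G e e' b.
Variable lam : 'rV[R]_(2 + n).
Implicit Type z : 'rV[R[i]]_n.

Let eps (k : 'I_n) : R[i] := (ksign R k)%:C.
Let P z := lam_psi G e e' b lam z.
Let dP z k := lam_psi_partial G e b lam z k.
Let Q z := (qY G b z)%:C.

(** The derivative of P along Y; it arises when the rank-one part of the cometric is contracted with
    the gradient of P. *)
Definition euler_sum z : R[i] := \sum_k ycoord z k * lam_psi_partial G e b lam z k.

(* The coefficient of pZ on the k-th (n, n-1) monomial, up to sign and volume. *)
Definition pZ_coef k z : R[i] :=
  4 * ycoord z k * (2 * euler_sum z + 'i%C * P z) - 4 * eps k * Q z * dP z k.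

Lemma pZ_hat z k : (0 < n)%N -> 0 < qY G b z -> pZ G e e' b lam z (hat k) =
  hat_sign R k * pZ_coef k z * vol_coef G b z.
Proof.
move=> n0 Q0; have q0 : Q z != 0 by rewrite fmorph_eq0 gt_eqF.
rewrite /pZ /xi fscaleE barstar01P // barstar01_hat herm_row1 big_split_ord /=.
rewrite (cometric_block GT hb Q0) big1 ?add0r => [|l _]; last by rewrite block_mxEdl mxE mulr0.
have fE z' : lam_psi G e e' b lam (map_mx conjc z') / (qY G b z')%:C =
    (P z' * (Q z')^-1)^*.
  rewrite (lam_psi_conj GT hb) conjcM; congr (_ * _).
  by rewrite conjcInv conjcR.
have D l : has_wirtinger l (fun z => (P z * (Q z)^-1)^*) z _ _ :=
  has_wirtinger_conj (has_wirtingerM (has_wirtinger_lam_psi GT hb lam l z)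
   (has_wirtingerV q0 (has_wirtinger_qY GT hb l z))).
(* This is the derivative of P / Q with respect to z_l: the function being differentiated is the
   conjugate of P / Q, and the conjugation in the inner product undoes this. *)
pose H l := dP z l / Q z + P z * ('i%C * eps l * ycoord z l) / Q z ^+ 2.
transitivity (Q z ^ 1 * (hat_sign R k * (\sum_l H l * cometric_coef G b z k l) * vol_coef G b z)).
  congr (_ * (_ * _ * _)); apply: eq_bigr => l _; rewrite block_mxEdr mxE; congr (_ * _).
  rewrite delbar_fconst.
  transitivity (d_zbar l (fun z => (P z * (Q z)^-1)^*) z)^*.
    by congr (conjc (d_zbar l _ z)); apply/funext => z'; exact: fE.
  rewrite (d_zbar_wirtinger (D l)) conjcInvol /H.
  by rewrite -/(eps l) -/(P z) -/(dP z l) -/(Q z); field.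
rewrite expr1z.
have -> : \sum_l H l * cometric_coef G b z k l = pZ_coef k z / Q z; last by field.
transitivity (\sum_l ((8 * ycoord z k / Q z) * (ycoord z l * dP z l)
   + (8 * 'i%C * P z * ycoord z k / Q z ^+ 2) * (eps l * ycoord z l ^+ 2)
   - (l == k)%:R * (4 * Q z * eps l * H l))).
  apply: eq_bigr => l _; rewrite /cometric_coef -/(Q z) (eq_sym k l) /H.
  have -> : 4 * Q z * (l == k)%:R * (ksign R k)%:C = 4 * Q z * ((l == k)%:R * eps l).
    by rewrite /eps; case: eqP => [->|_] /=; rewrite ?mulr0n ?mulr1n; ring.
  by field.
rewrite sumrB big_split /= -!mulr_sumr sum_delta -(qY_ycoord GT hb) -/(Q z) -/(euler_sum z).
rewrite /pZ_coef /H; have e2 := sqr_eps R k.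
transitivity (8 * ycoord z k / Q z * euler_sum z + 8 * 'i%C * P z * ycoord z k / Q z
  - (4 * eps k * dP z k + 4 * (eps k * eps k) * P z * 'i%C * ycoord z k / Q z)).
  by field.
by rewrite e2; field.
Qed.

Lemma has_wirtinger_lam_psi_partial j k z :
  has_wirtinger j (fun z => dP z k) z
    ((k == j)%:R * (- (2 * (bil G lam (latR R e))%:C * eps k))) 0.
Proof.
have := has_wirtingerD (has_wirtinger_cst j (bil G lam (row k b))%:C z)
  (has_wirtingerZ (- (2 * (bil G lam (latR R e))%:C * eps k)) (has_wirtinger_coord j k z)).
rewrite (_ : (fun z => _) = (fun z => dP z k)); last first.
  by apply/funext => z'; rewrite /dP /lam_psi_partial mulNr.
by move=> /has_wirtinger_eq; apply; rewrite ?mulr0 ?addr0 ?add0r // mulrC.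
Qed.

(** The conjugate derivatives of E in the first summand and of Q in the second cancel because
    eps_k^2 = 1, leaving a value independent of k. *)
Lemma has_wirtinger_pZ_coef k z : exists a, has_wirtinger k (pZ_coef k) z a
  (2 * 'i%C * (2 * euler_sum z + 'i%C * P z)).
Proof.
have DE := has_wirtinger_sum (index_enum 'I_n) (fun l =>
  has_wirtingerM (has_wirtinger_ycoord k l z) (has_wirtinger_lam_psi_partial k l z)).
have DP := has_wirtinger_lam_psi GT hb lam k z.
have Dy := has_wirtinger_ycoord k k z.
have DQ := has_wirtinger_qY GT hb k z.
have Dd := has_wirtinger_lam_psi_partial k k z.
have D := has_wirtingerD
  (has_wirtingerM (has_wirtingerZ 4 Dy)
     (has_wirtingerD (has_wirtingerZ 2 DE) (has_wirtingerZ 'i%C DP)))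
  (has_wirtingerN (has_wirtingerM (has_wirtingerZ (4 * eps k) DQ) Dd)).
eexists; apply: has_wirtinger_eq D (erefl _) _.
have -> : \sum_(l < n) ((l == k)%:R * ('i%C / 2) * dP z l + ycoord z l * 0)
    = 'i%C / 2 * dP z k.
  transitivity (\sum_l (l == k)%:R * ('i%C / 2 * dP z l)); last exact: sum_delta.
  by apply: eq_bigr => l _; rewrite mulr0 addr0 -mulrA.
rewrite eqxx -/(euler_sum z) -/(P z) -/(Q z); have e2 := sqr_eps R k.
transitivity (2 * 'i%C * (2 * euler_sum z + 'i%C * P z)
   + 4 * 'i%C * ycoord z k * dP z k * (1 - eps k * eps k)).
  by rewrite -/eps /=; field.
by rewrite e2 subrr mulr0 addr0.
Qed.

(** This contraction appears when Q^-n is differentiated, the conjugate derivative of Q being i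
    eps_k y_k. *)
Lemma sum_ycoord_pZ_coef z : \sum_k eps k * ycoord z k * pZ_coef k z =
  4 * Q z * (euler_sum z + 'i%C * P z).
Proof.
transitivity (\sum_k (4 * (2 * euler_sum z + 'i%C * P z) * (eps k * ycoord z k ^+ 2)
   - 4 * Q z * (ycoord z k * dP z k))).
  apply: eq_bigr => k _; rewrite /pZ_coef; have e2 := sqr_eps R k.
  transitivity (4 * (2 * euler_sum z + 'i%C * P z) * (eps k * ycoord z k ^+ 2)
     - 4 * Q z * (eps k * eps k) * (ycoord z k * dP z k)); first by ring.
  by rewrite e2 mulr1.
rewrite sumrB -!mulr_sumr -(qY_ycoord GT hb) -/(Q z) -/(euler_sum z); ring.
Qed.

(** Coordinates of [lam] with respect to e, etilde and the b_j, and four real sums. With Q, they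
    express P, E and the norm of the gradient. *)
Let B := bil G lam (latR R e).
Let C := bil G lam (etilde G e e').
Let A k := bil G lam (row k b).
Let xa z := \sum_k A k * complex.Re (z 0 k).
Let ya z := \sum_k A k * complex.Im (z 0 k).
Let xx z := \sum_k ksign R k * complex.Re (z 0 k) ^+ 2.
Let xy z := \sum_k ksign R k * (complex.Re (z 0 k) * complex.Im (z 0 k)).

Lemma lam_psi_Re_Im z : P z =
  (xa z - B * (xx z - qY G b z) + C) +i* (ya z - 2 * B * xy z).
Proof.
rewrite /P (lam_psiE GT hb) (qYE GT hb) /xa /xx /ya /xy.
apply/eqP; rewrite eq_complex; apply/andP; split; apply/eqP.
  transitivity (complex.Re (\sum_j (A j)%:C * z 0 j)
     - B * complex.Re (\sum_j (ksign R j)%:C * z 0 j ^+ 2) + C).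
    rewrite -/B -/C; move: (\sum_j _) (\sum_j (ksign R j)%:C * _) => [? ?] [? ?] /=.
    by ring.
  rewrite !Re_sum /= -sumrB; congr (_ - _ * _ + _); apply: eq_bigr => j _.
    by case: (z 0 j) => ? ? /=; ring.
  by rewrite expr2; case: (z 0 j) => ? ? /=; ring.
transitivity (complex.Im (\sum_j (A j)%:C * z 0 j)
   - B * complex.Im (\sum_j (ksign R j)%:C * z 0 j ^+ 2)).
  rewrite -/B -/C; move: (\sum_j _) (\sum_j (ksign R j)%:C * _) => [? ?] [? ?] /=.
  by ring.
rewrite !Im_sum /=.
rewrite [2 * B * _](_ : _ = B * (\sum_j 2 * (ksign R j * (complex.Re (z 0 j) * complex.Im (z 0 j))))); last first.
  by rewrite -mulr_sumr; ring.
congr (_ - _ * _); apply: eq_bigr => j _.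
  by case: (z 0 j) => ? ? /=; ring.
by rewrite expr2; case: (z 0 j) => ? ? /=; ring.
Qed.

Lemma euler_sum_Re_Im z : euler_sum z =
  (ya z - 2 * B * xy z) +i* (- (2 * B * qY G b z)).
Proof.
rewrite /euler_sum (qYE GT hb) /ya /xy.
apply/eqP; rewrite eq_complex; apply/andP; split; apply/eqP.
  rewrite Re_sum /= [2 * B * _]mulr_sumr -sumrB; apply: eq_bigr => k _.
  (* Writing 2 as 1 + 1 lets the real and imaginary parts compute by reduction. *)
  rewrite /lam_psi_partial /ycoord -/B -/(A k) -[2]/(1 + 1).
  by case: (z 0 k) => u v /=; ring.
rewrite Im_sum /= mulr_sumr -sumrN; apply: eq_bigr => k _.
rewrite /lam_psi_partial /ycoord -/B -/(A k) -[2]/(1 + 1).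
by case: (z 0 k) => u v /=; ring.
Qed.

Lemma sum_norm_partial z : \sum_k eps k * dP z k * (dP z k)^* =
  (4 * (quad G lam - B * C) - 4 * B * xa z + 4 * B ^+ 2 * (xx z + qY G b z))%:C.
Proof.
rewrite (quad_coord GT hsig heq hee' hb) -/B -/C addrK (qYE GT hb) /xa /xx.
rewrite -big_split /= !mulr_sumr -sumrB -big_split /= rmorph_sum.
apply: eq_bigr => k _; rewrite /dP /lam_psi_partial /eps -/B -/(A k) -[2 in LHS]/(1 + 1).
have := sqr_ksign R k; move: (ksign R k) (A k) => s a s2.
case: (z 0 k) => u v; apply/eqP; rewrite eq_complex; apply/andP; split; apply/eqP => /=.
  transitivity (4 * (s * a ^+ 2 / 4) - 4 * B * (s * s * (a * u))
    + 4 * B ^+ 2 * (s * s * (s * u ^+ 2) + s * s * (s * v ^+ 2))); first by field.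
  by rewrite s2 !mul1r.
by ring.
Qed.

(** Here q(lam) enters, through its coordinate formula. In the real quantities above both components
    are polynomial identities; the lemma serves to eliminate the squared norm of the gradient of
    P. *)
Lemma euler_identity z : Q z * (\sum_k eps k * dP z k * (dP z k)^*) =
  2 * euler_sum z * (euler_sum z)^* + 'i%C * (P z * (euler_sum z)^* - (P z)^* * euler_sum z)
  + 4 * (quad G lam)%:C * Q z.
Proof.
rewrite sum_norm_partial euler_sum_Re_Im lam_psi_Re_Im /Q -[2]/(1 + 1) -[4 in RHS]/(4%:R).
rewrite -(rmorph_nat (real_complex R) 4).
apply/eqP; rewrite eq_complex; apply/andP; split; apply/eqP => /=; ring.
Qed.

(* This is q(lam_(Z^+)) for z in the tube. *)
Definition radius z : R :=
  (complex.Re (P z) ^+ 2 + complex.Im (P z) ^+ 2) / (4 * qY G b z).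

Lemma radiusE z : (radius z)%:C = P z * (P z)^* / (4 * Q z).
Proof.
rewrite /radius fmorph_div rmorphM rmorph_nat; congr (_ / _).
by case: (P z) => u v; apply/eqP; rewrite eq_complex /=; apply/andP; split; apply/eqP; ring.
Qed.

Lemma has_wirtinger_radius k z : 0 < qY G b z -> exists a,
  has_wirtinger k (fun z => (radius z)%:C) z a
   (P z * (dP z k)^* / (4 * Q z) - (radius z)%:C * 'i%C * eps k * ycoord z k / Q z).
Proof.
move=> Q0; have q0 : Q z != 0 by rewrite fmorph_eq0 gt_eqF.
have q40 : 4 * Q z != 0 by rewrite mulf_neq0 ?pnatr_eq0.
have DP := has_wirtinger_lam_psi GT hb lam k z.
have D := has_wirtingerM (has_wirtingerM DP (has_wirtinger_conj DP))
  (has_wirtingerV q40 (has_wirtingerZ 4 (has_wirtinger_qY GT hb k z))).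
eexists; rewrite (_ : (fun z => (radius z)%:C) =
  (fun z => P z * (P z)^* * (4 * Q z)^-1)); last by apply/funext => z'; rewrite radiusE.
apply: has_wirtinger_eq D (erefl _) _.
by rewrite radiusE -/eps -/(P z) -/(Q z) -/(dP z k); field.
Qed.

(** Substituting [euler_identity] cancels all terms in E and its conjugate; only |P|^2 and q(lam)
    remain. *)
Lemma sum_radius_pZ_coef z : 0 < qY G b z ->
  \sum_k (P z * (dP z k)^* / (4 * Q z) - (radius z)%:C * 'i%C * eps k * ycoord z k / Q z)
     * pZ_coef k z
  = 4 * P z * (radius z - quad G lam)%:C.
Proof.
move=> Q0; have q0 : Q z != 0 by rewrite fmorph_eq0 gt_eqF.
have Dc : (euler_sum z)^* = \sum_k ycoord z k * (dP z k)^*.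
  by rewrite /euler_sum conjc_sum; apply: eq_bigr => k _; rewrite conjcM conjcR.
set S := \sum_k eps k * dP z k * (dP z k)^*.
transitivity (P z / Q z * ((2 * euler_sum z + 'i%C * P z) * (euler_sum z)^* - Q z * S)
   - (radius z)%:C * 'i%C / Q z * (4 * Q z * (euler_sum z + 'i%C * P z))).
  rewrite -sum_ycoord_pZ_coef Dc /S /pZ_coef; move: (euler_sum z) => E.
  rewrite !mulr_sumr -sumrB mulr_sumr -sumrB.
  by apply: eq_bigr => k _; field.
rewrite euler_identity rmorphB /= radiusE.
have ii := sqr_iC R.
transitivity (P z / Q z * (- ('i%C * 'i%C) * (P z * (P z)^*) - 4 * (quad G lam)%:C * Q z)).
  by field.
by rewrite ii; field.
Qed.


Variables (kappa : int) (F : R[i] -> R[i]) (f : R -> R).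
Hypothesis Ff : forall x, x < 1 -> F x%:C = (f x)%:C.
Let h : R := n%:R / 2.
Let q := quad G lam.

(** The part of the (n, n-1)-coefficients that depends on Z, with constants and signs split off. The
    power Q^-n comes from the volume form. *)
Definition ptilde_coef k z : R[i] := P z ^ (kappa - 1)
  * (radial h q kappa f (radius z))%:C * Q z ^ (- n%:Z) * pZ_coef k z.

Lemma radius_ge0 z : 0 < qY G b z -> 0 <= radius z.
Proof.
by move=> Q0; rewrite /radius divr_ge0 ?addr_ge0 ?sqr_ge0 // mulr_ge0 // ltW.
Qed.

Lemma ptilde_hat k z : (0 < n)%N -> 0 < qY G b z -> 0 < radius z - q ->
  ptilde G e e' b kappa F lam z (hat k) =
  hat_sign R k * (vol_sign R n * (4 * 'i%C) ^- n) * ptilde_coef k z.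
Proof.
move=> n0 Q0 rq; rewrite /ptilde fscaleE (pZ_hat _ n0 Q0).
rewrite (quad_lamminus GT heq hee' hb lam Q0) (quad_lamplus GT heq hee' hb lam Q0).
rewrite -/(radius z) opprB -/q -/h Ff; last first.
  (* The hypotheses allow [radius z = 0]; then q / 0 = 0 by convention, still below 1. *)
  have := radius_ge0 Q0; rewrite le_eqVlt => /orP[/eqP <-|r0].
    by rewrite invr0 mulr0 ltr01.
  by rewrite ltr_pdivrMr // mul1r -subr_gt0.
rewrite /ptilde_coef /radial; set X := 4 ^ (kappa + 1) * _ * _.
have rE (x y w : R) : (x^-1 * y * w)%:C = (x%:C)^-1 * y%:C * w%:C.
  by rewrite !rmorphM fmorphV.
have vE : vol_coef G b z = vol_sign R n * (4 * 'i%C) ^- n * Q z ^ (- n%:Z).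
  by rewrite /vol_coef -/(Q z) exprMn invfM -exprnN mulrA.
rewrite rE vE -/(P z); move: (hat_sign R k) (vol_sign R n * _) (P z ^ _) (Q z ^ _) => a1 a2 a3 a4.
move: (X%:C^-1) (_%:C) ((f _)%:C) (pZ_coef k z) => a5 a6 a7 a8.
by ring.
Qed.

Lemma sum_d_zbar_ptilde z df : (0 < n)%N -> 0 < qY G b z -> 0 < radius z ->
  q < radius z -> kappa%:~R - h != 0 -> is_derive (q / radius z) 1 f df ->
  q / radius z * df + (kappa%:~R - h) * f (q / radius z)
    = (kappa%:~R - h) * (1 - q / radius z) `^ (h - 1) ->
  \sum_(k < n) hat_sign R k * d_zbar k (fun z => ptilde G e e' b kappa F lam z (hat k)) z =
  vol_sign R n * (4 * 'i%C) ^- n * (Q z ^ kappa * Q z ^ (- n%:Z) * ((P z)^*) ^ (- kappa)).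
Proof.
move=> n0 Q0 r0 qr kh Df ode.
have [dphi Dphi eqphi] := radial_ode kh r0 qr Df ode.
set phi := radial h q kappa f (radius z) in eqphi.
have q0 : Q z != 0 by rewrite fmorph_eq0 gt_eqF.
have P0 : P z != 0.
  by apply: contraTneq r0 => Pz; rewrite /radius Pz /= expr0n /= addr0 mul0r ltxx.
have Pc0 : (P z)^* != 0 by apply: contra P0 => /eqP E; rewrite -[P z]conjcInvol E conjcZero.
have rq : 0 < radius z - q by rewrite subr_gt0.
pose t k := P z * (dP z k)^* / (4 * Q z) - (radius z)%:C * 'i%C * eps k * ycoord z k / Q z.
(* The conjugate derivative of [ptilde_coef k] by the product rule. The power of P contributes
   nothing, P being holomorphic. *)
pose beta k := P z ^ (kappa - 1) * Q z ^ (- n%:Z) * (dphi%:C * (t k * pZ_coef k z)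
   + phi%:C * (2 * 'i%C * (2 * euler_sum z + 'i%C * P z)
       - n%:R * 'i%C / Q z * (eps k * ycoord z k * pZ_coef k z))).
have Dk k : d_zbar k (fun z => ptilde G e e' b kappa F lam z (hat k)) z =
    hat_sign R k * (vol_sign R n * (4 * 'i%C) ^- n) * beta k.
  have DQ := has_wirtinger_qY GT hb k z.
  have [ar Dr] := has_wirtinger_radius k Q0.
  have [aN DN] := has_wirtinger_pZ_coef k z.
  have := has_wirtingerD Dr (has_wirtinger_cst k (- q)%:C z).
  rewrite (_ : (fun z => _) = fun z => (radius z - q)%:C) => [DrB|]; last first.
    by apply/funext => z'; rewrite rmorphD.
  have D := has_wirtingerM (has_wirtingerM (has_wirtingerM
    (has_wirtinger_exprz (kappa - 1) P0 (has_wirtinger_lam_psi GT hb lam k z))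
    (has_wirtinger_real_comp Dr Dphi)) (has_wirtinger_exprz (- n%:Z) q0 DQ)) DN.
  apply: d_zbar_wirtinger (_ : has_wirtinger _ _ _ _ _).
  apply: has_wirtinger_eq_pos DQ Q0 DrB rq _ _; last first.
    apply: has_wirtinger_eq (has_wirtingerZ (hat_sign R k * (vol_sign R n * (4 * 'i%C) ^- n)) D)
      (erefl _) _.
    congr (_ * _); rewrite /beta -/(t k) -/(P z) -/(Q z) -/phi -/eps /=.
    rewrite (expfzDr (- n%:Z) (- 1) q0) exprN1 mulrNz -pmulrn; field; exact: q0.
  by move=> z' Q0' rq'; rewrite ptilde_hat.
transitivity (vol_sign R n * (4 * 'i%C) ^- n * \sum_k beta k).
  rewrite mulr_sumr; apply: eq_bigr => k _; rewrite Dk.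
  (* The sign from the wedge with d\bar z_k meets the one left by the Hodge operator in bidegree (0,
     1). *)
  have ss : hat_sign R k * hat_sign R k = 1 := sqr_shuffle_sign _ _ _.
  move: (hat_sign R k) ss (vol_sign R n * _) (beta k) => s ss V w.
  by rewrite !mulrA ss mul1r.
congr (_ * _); rewrite /beta -mulr_sumr big_split /= -!mulr_sumr sumrB -!mulr_sumr.
rewrite (sum_radius_pZ_coef Q0) sum_ycoord_pZ_coef sumr_const card_ord -mulr_natr.
have ii := sqr_iC R.
(* The terms in E cancel: 2 n i (2 E + i P) - 4 n i (E + i P) = 2 n P. *)
transitivity (P z ^ (kappa - 1) * Q z ^ (- n%:Z) * (4 * P z) *
   (h * phi + (radius z - q) * dphi)%:C).
  have hC : h%:C = n%:R / 2 by rewrite fmorph_div !rmorph_nat.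
  have -> : (h * phi + (radius z - q) * dphi)%:C =
      h%:C * phi%:C + (radius z - quad G lam)%:C * dphi%:C.
    by rewrite rmorphD (rmorphM _ h) (rmorphM _ (radius z - q)).
  rewrite hC; move: (P z ^ _) (Q z ^ _) (radius z - quad G lam)%:C => a1 a2 a3.
  transitivity (a1 * a2 * (dphi%:C * (4 * P z * a3)
     + phi%:C * (('i%C * 'i%C) * (2 * n%:R * P z - 4 * n%:R * P z)))); first by field.
  by rewrite ii; field.
have -> : (h * phi + (radius z - q) * dphi)%:C = 4 ^ (- kappa - 1) * (radius z)%:C ^ (- kappa).
  by rewrite eqphi rmorphM !fmorphXz rmorph_nat.
rewrite radiusE.
rewrite !expfzMl exprz_inv opprK expfzMl.
have n4 : (4 : R[i]) != 0 by rewrite pnatr_eq0.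
rewrite (expfzDr kappa (- 1) P0) (expfzDr (- kappa) (- 1) n4) !exprN1.
move: (Q z ^ (- n%:Z)) (Q z ^ kappa) => x1 x2; rewrite -!invr_expz.
have Pk : P z ^ kappa != 0 by rewrite expfz_neq0.
have Pck : (P z)^* ^ kappa != 0 by rewrite expfz_neq0.
have k4 : (4 : R[i]) ^ kappa != 0 by rewrite expfz_neq0.
move: (P z ^ kappa) (_^* ^ kappa) (4 ^ kappa) Pk Pck k4 => x3 x4 x5 y3 y4 y5.
move: (P z) P0 => x6 y6.
by field; rewrite y3 y4 y5 y6.
Qed.

End PolarPart.

(** * Reduction to the top-degree coefficient and comparison of constants *)

Theorem theorem3p10 (R : realType) (n : nat) (G : 'M[int]_(2 + n))
  (hL : even_lattice G) (hsig : signature_2n R G)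
  (e : 'rV[int]_(2 + n)) (he : primitive_vector e)
  (heq : quad G (latR R e) = 0)
  (e' : 'rV[R]_(2 + n)) (he' : dual_vector G e') (hee' : bil G (latR R e) e' = 1)
  (b : 'M[R]_(n, 2 + n)) (hb : orthogonal_basis_K G e e' b)
  (Hn : set 'rV[R[i]^o]_n)
  (hHn : exists2 Z0, tube G b Z0 & Hn = connected_component (tube G b) Z0)
  (kappa : int) (hkappa : kappa%:~R <> n%:R / 2 :> R)
  (F : R[i] -> R[i])
  (hF : principal_2F1 (1 - n%:R / 2) (kappa%:~R - n%:R / 2)
          (kappa%:~R - n%:R / 2 + 1) F)
  (lam : 'rV[R]_(2 + n)) (Z : 'rV[R[i]^o]_n) (hZ : Hn Z)
  (hplus : quad G (lamplus G e e' b lam Z) <> 0)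
  (hminus : quad G (lamminus G e e' b lam Z) <> 0) :
  xi G b n n.-1 (- kappa) (ptilde G e e' b kappa F lam) Z =
  fconst n (1 / lam_psi G e e' b lam Z ^ kappa).
Proof.
have [GT _] := hL.
have [Z0 _ HnE] := hHn.
have Q0 : 0 < qY G b Z by move: hZ; rewrite HnE => /connected_component_sub.
(* For n = 0 the value [qY] is an empty sum, so the tube is empty. Positivity of n makes [n.-1] the
   true degree n - 1. *)
have n0 : (0 < n)%N.
  rewrite lt0n; apply/eqP => n0; subst n.
  by move: Q0; rewrite (qYE GT hb) big_ord0 ltxx.
have rE : quad G (lamplus G e e' b lam Z) = radius G e e' b lam Z.
  by rewrite (quad_lamplus GT heq hee' hb lam Q0).
have r0 : 0 < radius G e e' b lam Z.
  by rewrite lt_neqAle radius_ge0 // andbT eq_sym; apply/eqP; rewrite -rE.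
have qr : quad G lam < radius G e e' b lam Z.
  have mE := quad_lamminus GT heq hee' hb lam Q0.
  rewrite -subr_lt0 -rE -mE lt_neqAle; apply/andP; split; first exact/eqP.
  exact: (quad_lamminus_le0 GT hsig heq hee' hb lam Q0).
have [f [Ff ode]] := principal_2F1_ode hF.
have w1 : quad G lam / radius G e e' b lam Z < 1 by rewrite ltr_pdivrMr // mul1r.
have [df Df odeZ] := ode _ w1.
have kh : kappa%:~R - n%:R / 2 != 0 :> R by rewrite subr_eq0; apply/eqP.
have S := sum_d_zbar_ptilde GT hsig heq hee' hb Ff n0 Q0 r0 qr kh Df odeZ.
rewrite /xi prednK // barstarnnP (det_cometric GT hb Q0).
set v := delbar _ Z.
(* The generator d\bar z_k reaches the full monomial only from the coefficient on [hat k]. *)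
have vT : v [set: 'I_(n + n)]%SET = \sum_(k < n) hat_sign R k *
    d_zbar k (fun z => ptilde G e e' b kappa F lam z (hat k)) Z.
  rewrite /v /delbar form_sumE; apply: eq_bigr => k _.
  by rewrite wedge_gen inE ffunE.
rewrite vT S; apply/ffunP => T; rewrite fscaleE !fconstE.
case: ifP => _; last by rewrite mulr0.
have q0 : (qY G b Z)%:C != 0 by rewrite fmorph_eq0 gt_eqF.
set P := lam_psi G e e' b lam Z; set Q := (qY G b Z)%:C in q0 *.
have P0 : P != 0.
  by apply: contraTneq r0 => Pz; rewrite /radius -/P Pz /= expr0n /= addr0 mul0r ltxx.
(* The Hodge operator is conjugate-linear: conjugation turns the power of the conjugate of P into
   P^(-kappa), and i into -i. *)
have conjE : (vol_sign R n * (4 * 'i%C) ^- n * (Q ^ kappa * Q ^ (- n%:Z) * (P^*) ^ (- kappa)))^*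
    = vol_sign R n * (4 * - 'i%C) ^- n * (Q ^ kappa * Q ^- n * P ^ (- kappa)).
  have cZ (x : R[i]) (k : int) : (x ^ k)^* = (x^*) ^ k by exact: fmorphXz.
  have ci : ('i%C : R[i])^* = - 'i%C by apply/eqP; rewrite eq_complex /= oppr0 !eqxx.
  have cv : (vol_sign R n)^* = vol_sign R n := vol_sign_conj R n.
  have c1 : ((4 * 'i%C : R[i]) ^- n)^* = (4 * - 'i%C) ^- n.
    by rewrite conjcInv conjcX conjcM ci conjcNat.
  have cQ (k : int) : (Q ^ k)^* = Q ^ k by rewrite cZ conjcR.
  have cP : ((P^*) ^ (- kappa))^* = P ^ (- kappa) by rewrite cZ conjcInvol.
  have c5 (x1 x2 x3 x4 x5 : R[i]) :
      (x1 * x2 * (x3 * x4 * x5))^* = x1^* * x2^* * (x3^* * x4^* * x5^*).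
    by rewrite !conjcM.
  have cQn : (Q ^ (- n%:Z))^* = Q ^- n by rewrite cQ -exprnN.
  move: cv c1 (cQ kappa) cQn cP => E1 E2 E3 E4 E5.
  by apply: etrans (c5 _ _ _ _ _) _; congr (_ * _ * (_ * _ * _)).
transitivity (Q ^ (- kappa) * (vol_sign R n * (4 * - 'i%C) ^- n
   * (Q ^ kappa * Q ^- n * P ^ (- kappa)) * (4 * Q) ^+ (2 * n) * vol_coef G b Z)).
  by congr (_ * (_ * _ * _)); exact: conjE.
rewrite /vol_coef -/Q -!invr_expz mul2n -addnn exprD.
have Qk : Q ^ kappa != 0 by rewrite expfz_neq0.
have Pk : P ^ kappa != 0 by rewrite expfz_neq0.
have vs := sqr_vol_sign R n.
have ii : (4 * - 'i%C) ^+ n * (4 * 'i%C) ^+ n = 4 ^+ n * 4 ^+ n :> R[i].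
  by rewrite -!exprMn mulrACA mulNr sqr_iC opprK mulr1.
have j0 : (4 * - 'i%C) ^+ n * (4 * 'i%C) ^+ n != 0 :> R[i].
  by rewrite ii mulf_neq0 // expf_neq0 // pnatr_eq0.
have e1 : (4 * Q) ^+ n = 4 ^+ n * Q ^+ n by rewrite exprMn.
have e2 : (4 * 'i%C * Q) ^+ n = (4 * 'i%C) ^+ n * Q ^+ n by rewrite exprMn.
rewrite e1 e2.
have Qn : Q ^+ n != 0 by rewrite expf_neq0.
move: j0; rewrite mulf_eq0 negb_or => /andP[j1 j2].
(* All powers of Q cancel against those of [det_cometric] and [vol_coef]; what is left is the
   squared orientation sign and i^n (-i)^n = 1. *)
transitivity ((vol_sign R n * vol_sign R n) * (4 ^+ n * 4 ^+ n)
   / ((4 * - 'i%C) ^+ n * (4 * 'i%C) ^+ n) * (1 / P ^ kappa)); last first.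
  by rewrite vs ii mul1r mulfV ?mul1r // -ii mulf_neq0.
move: (Q ^ kappa) (P ^ kappa) (Q ^+ n) ((4 * - 'i%C) ^+ n) ((4 * 'i%C) ^+ n) (vol_sign R n) (4 ^+ n)
  Qk Pk Qn j1 j2 => x1 x2 x3 x4 x5 x6 x7 y1 y2 y3 y4 y5.
by field; rewrite y1 y2 y3 y4 y5.
Qed.
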